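(* Let $K$ be an arbitrary field. Let $\Delta$ be a simplicial complex on $[n]$ and let $\Delta^c$ be a combinatorial shifted complex of $\Delta$. Then $$\beta_{i\,i+j}(I_\Delta)\leq\beta_{i\,i+j}(I_{\Delta^c})$$ for all $i$ and $j$.
   Context: $[n]=\{1,\ldots,n\}$ and $S=K[x_1,\ldots,x_n]$ is the polynomial ring with each $\deg x_i=1$. For a homogeneous ideal $I\subset S$, $\beta_{ij}(I)=\dim_K \mathrm{Tor}^S_i(K,I)_j$ denotes the graded Betti numbers. A simplicial complex $\Delta$ on $[n]$ is a collection of subsets of $[n]$ with $\{j\}\in\Delta$ for all $j\in[n]$ and such that $\tau\subset\sigma\in\Delta$ implies $\tau\in\Delta$. Its Stanley–Reisner ideal $I_\Delta\subset S$ is generated by the squarefree monomials $x_\sigma=\prod_{k\in\sigma}x_k$ with $\sigma\subset[n]$, $\sigma\notin\Delta$. $\Delta$ is shifted if for each $\sigma\in\Delta$ and $i\in\sigma$ one has $(\sigma\setminus\{i\})\cup\{j\}\in\Delta$ for all $j>i$ with $j\notin\sigma$. For $1\le i<j\le n$, $\mathrm{Shift}_{ij}(\Delta)$ is the simplicial complex on $[n]$ whose faces are the sets $C_{ij}(\sigma)$, $\sigma\in\Delta$, where $C_{ij}(\sigma)=(\sigma\setminus\{i\})\cup\{j\}$ if $i\in\sigma$, $j\notin\sigma$ and $(\sigma\setminus\{i\})\cup\{j\}\notin\Delta$, and $C_{ij}(\sigma)=\sigma$ otherwise. A combinatorial shifted complex $\Delta^c$ of $\Delta$ is any shifted complex of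 the form $\mathrm{Shift}_{i_qj_q}(\cdots(\mathrm{Shift}_{i_1j_1}(\Delta))\cdots)$ for a finite sequence of pairs $1\le i_k<j_k\le n$ (it exists but need not be unique). *)

(* Defs.v *)
From mathcomp Require Import all_boot all_order all_algebra.
From mathcomp Require Import mpoly.
From Stdlib Require Import ClassicalEpsilon.

Set Implicit Arguments.
Unset Strict Implicit.
Unset Printing Implicit Defensive.

Import Order.TTheory GRing.Theory Num.Theory.
Local Open Scope ring_scope.

(* The vertex set [n] = {1, ..., n} is 'I_n = {0, ..., n-1}; only the order of
   the vertices matters. *)

Section Complexes.
Variable n : nat.
Implicit Types (D E : {set {set 'I_n}}) (s t : {set 'I_n}) (i j : 'I_n).

Definition simplicial_complex D : Prop :=
  (forall j, [set j] \in D) /\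
  (forall s t, t \subset s -> s \in D -> t \in D).

Definition shifted D : Prop :=
  forall s i j, s \in D -> i \in s -> (i < j)%N -> j \notin s ->
    j |: (s :\ i) \in D.

Definition shift_face D i j s : {set 'I_n} :=
  if [&& i \in s, j \notin s & j |: (s :\ i) \notin D]
  then j |: (s :\ i) else s.

Definition shift D i j : {set {set 'I_n}} := [set shift_face D i j s | s in D].

Definition combinatorial_shifted_complex D Dc : Prop :=
  (exists ps : seq ('I_n * 'I_n),
     (forall p, p \in ps -> (p.1 < p.2)%N) /\
     Dc = foldl (fun E p => shift E p.1 p.2) D ps) /\
  shifted Dc.

End Complexes.

Definition SR_ideal (K : fieldType) (n : nat) (D : {set {set 'I_n}})
    (f : {mpoly K[n]}) : Prop :=
  exists c : {set 'I_n} -> {mpoly K[n]},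
    f = \sum_(s : {set 'I_n} | s \notin D) c s * \prod_(k in s) 'X_k.

(* p lies in the graded component S_d; this includes p = 0, and forces p = 0
   when d < 0. *)
Definition homog_deg (K : fieldType) (n : nat) (d : int) (p : {mpoly K[n]}) :
    Prop :=
  forall m, m \in msupp p -> (mdeg m)%:Z = d.

(* A graded free resolution
     ... -> F_2 -> F_1 -> F_0 -> K -> 0
   of K = S/(x_1, ..., x_n) over S = K[x_1, ..., x_n], with every
   F_i = \bigoplus_b S(- fr_deg i b) of finite rank.  Elements of F_i are row
   vectors and the maps act by multiplication on the right.  S acts on K
   through constant coefficients, so the augmentation F_0 -> K sends v to
   \sum_b v_b(0) * fr_aug b; K sits in degree 0. *)
Record free_resolution (K : fieldType) (n : nat) := FreeResolution {
  fr_rank : nat -> nat;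
  fr_deg : forall i, 'I_(fr_rank i) -> int;
  fr_diff : forall i, 'M[{mpoly K[n]}]_(fr_rank i.+1, fr_rank i);
  fr_aug : 'I_(fr_rank 0) -> K;
  fr_diff_homog : forall i a b,
    homog_deg (fr_deg a - fr_deg b) (fr_diff i a b);
  fr_aug_homog : forall b, fr_aug b != 0 -> fr_deg b = 0;
  fr_aug_surj : exists b, fr_aug b != 0;
  fr_exact0 : forall v : 'rV[{mpoly K[n]}]_(fr_rank 0),
    \sum_b (v 0 b)@_0%MM * fr_aug b = 0 <->
    exists w : 'rV_(fr_rank 1), v = w *m fr_diff 0;
  fr_exactS : forall i (v : 'rV[{mpoly K[n]}]_(fr_rank i.+1)),
    v *m fr_diff i = 0 <->
    exists w : 'rV_(fr_rank i.+2), v = w *m fr_diff i.+1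
}.

Section Tor.
Variables (K : fieldType) (n : nat).
Implicit Types (F : free_resolution K n) (I : {mpoly K[n]} -> Prop).

(* For an ideal I, F_i \otimes_S I is identified with \bigoplus_b I(- fr_deg b),
   the row vectors with entries in I; this is its component of degree d. *)
Definition tensor_comp F I (i : nat) (d : int)
    (v : 'rV[{mpoly K[n]}]_(fr_rank F i)) : Prop :=
  forall b, I (v 0 b) /\ homog_deg (d - fr_deg b) (v 0 b).

Definition tor_closed F (i : nat) : 'rV[{mpoly K[n]}]_(fr_rank F i) -> Prop :=
  match i with
  | 0 => fun _ => True
  | i'.+1 => fun v => v *m fr_diff F i' = 0
  end.

Definition tor_cycle F I (i : nat) (d : int)
    (v : 'rV[{mpoly K[n]}]_(fr_rank F i)) : Prop :=
  tensor_comp I d v /\ tor_closed v.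

Definition tor_boundary F I (i : nat) (d : int)
    (v : 'rV[{mpoly K[n]}]_(fr_rank F i)) : Prop :=
  exists w : 'rV_(fr_rank F i.+1), tensor_comp I d w /\ v = w *m fr_diff F i.

(* dim_K H_i(F \otimes_S I)_d = r: some r cycles form a K-basis of the cycles
   modulo the boundaries. *)
Definition tor_dim F I (i : nat) (d : int) (r : nat) : Prop :=
  exists z : 'I_r -> 'rV[{mpoly K[n]}]_(fr_rank F i),
    (forall k, tor_cycle I d (z k)) /\
    (forall v, tor_cycle I d v ->
       exists! c : 'rV[K]_r,
         tor_boundary I d (v - \sum_k (c 0 k)%:MP *: z k)).

(* dim_K Tor_i^S(K, I)_d for a homogeneous ideal I.  It is computed from any
   graded free resolution of K, and does not depend on which one is used. *)
Definition betti I (i : nat) (d : int) : nat :=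
  epsilon (inhabits 0%N) (fun r => exists F, @tor_dim F I i d r).

End Tor.

(* Main.v *)
From HB Require Import structures.
Require Import Defs.
From mathcomp Require Import all_boot all_order all_algebra.
From mathcomp Require Import perm mpoly.
From mathcomp Require Import ring zify.
From Stdlib Require Import ClassicalEpsilon.

Set Implicit Arguments.
Unset Strict Implicit.
Unset Printing Implicit Defensive.

Import Order.TTheory GRing.Theory Num.Theory.
Local Open Scope ring_scope.

(** Shifts preserve closure under taking subsets, so it is enough to compare a
complex D with a single shift D' = Shift_ij(D).

The Koszul complex on e_1, ..., e_n resolves K, so Tor(K, I_D) is the homology
of the complex with K-basis e_s x^m, where the support of x^m is not in D.  It
splits by multidegree, and in a multidegree a with some a_k > 1 it is
contractible by e_k x_k^-1.  What remains is a finite complex T(D) with basis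
e_s x_t, where s and t are disjoint and t is not in D, and differential
e_s x_t -> sum over k in s of +- e_(s - k) x_(t + k).  The graded Betti number
of I_D is therefore dim T_i - rank(d on T_i) - rank(d on T_(i+1))
([betti_strand]).

To compare T(D) with T(D'), identify the variables i and j: the substitution
e_j := e_i, x_j := x_i is a chain map, realised on squarefree terms as an
idempotent linear map ([collapse]).  On the part spanned by the normal forms it
is the identity, so D' being obtained from D by pushing non-faces from j to i
means three things: T(D) and T(D') have the same image under it, they meet its
kernel in the same subspace, and T(D') contains the image.  Thus T(D) and T(D')
are extensions of the same complex by the same complex, and the extension given
by T(D') splits.  It follows that they have equal dimensions and that the
differential has at most the same rank on T(D') as on T(D) ([rank_collapse]),
which is the inequality of Betti numbers ([strand_betti_shift]).

The Betti numbers are defined through an unspecified graded free resolution of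
K.  Lifting chain maps and homotopies between two resolutions shows that the
dimension of Tor does not depend on the choice ([tor_dim_le]), so that the
Koszul complex may be used. *)

(** * Polynomials with prescribed coefficients and homogeneous parts *)

Section Polynomials.
Variables (K : fieldType) (n : nat).
Implicit Types (p q : {mpoly K[n]}) (m : 'X_{1..n}).

(** The list [s] only has to contain the support of [c]; duplicates are
harmless. *)
Definition mpoly_of_coef (s : seq 'X_{1..n}) (c : 'X_{1..n} -> K) : {mpoly K[n]} :=
  \sum_(m <- undup s) c m *: 'X_[m].

Lemma mcoeff_mpoly_of_coef s c m :
  (forall m', c m' != 0 -> m' \in s) -> (mpoly_of_coef s c)@_m = c m.
Proof.
move=> cs; rewrite /mpoly_of_coef raddf_sum /=.
under eq_bigr => m' _ do rewrite mcoeffZ mcoeffX.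
case: (boolP (m \in undup s)) => [ms | mNs].
  rewrite (bigD1_seq m) ?undup_uniq //= eqxx mulr1 big1 ?addr0 // => m' /negPf->.
  by rewrite mulr0.
rewrite big_seq big1 => [|m' m's]; last first.
  by case: eqP => [e|]; rewrite ?mulr0 // -e m's in mNs *.
by apply/esym/eqP; apply: contraNT mNs => /cs; rewrite mem_undup.
Qed.

Lemma msuppM_split p q m : m \in msupp (p * q) ->
  exists m1 m2, [/\ m1 \in msupp p, m2 \in msupp q & m = (m1 + m2)%MM].
Proof. by move/msuppM_le => /allpairsP [[m1 m2] /= [h1 h2 h3]]; exists m1, m2. Qed.

Lemma msupp_sum_ex (I : Type) (r : seq I) (P : pred I) (F : I -> {mpoly K[n]}) m :
  m \in msupp (\sum_(i <- r | P i) F i) -> exists2 i, P i & m \in msupp (F i).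
Proof.
elim/big_rec: _ => [|i p Pi IH]; first by rewrite msupp0.
by move/msuppD_le; rewrite mem_cat => /orP [|/IH //]; exists i.
Qed.

Lemma homog_degB d p q : homog_deg d p -> homog_deg d q -> homog_deg d (p - q).
Proof.
by move=> hp hq m /msuppB_le; rewrite mem_cat => /orP [/hp|/hq].
Qed.

Lemma homog_degD d p q : homog_deg d p -> homog_deg d q -> homog_deg d (p + q).
Proof.
by move=> hp hq m /msuppD_le; rewrite mem_cat => /orP [/hp|/hq].
Qed.

Lemma homog_degM d e p q :
  homog_deg d p -> homog_deg e q -> homog_deg (d + e) (p * q).
Proof.
move=> hp hq m /msuppM_split [m1 [m2 [/hp h1 /hq h2 ->]]].
by rewrite mdegD PoszD h1 h2.
Qed.

Lemma homog_deg0 d : homog_deg d (0 : {mpoly K[n]}).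
Proof. by move=> m; rewrite msupp0. Qed.

Lemma homog_deg_sum d (I : Type) (r : seq I) (P : pred I) (F : I -> {mpoly K[n]}) :
  (forall i, P i -> homog_deg d (F i)) -> homog_deg d (\sum_(i <- r | P i) F i).
Proof. by move=> h m /msupp_sum_ex [i /h]; apply. Qed.

Lemma homog_degC (c : K) : homog_deg 0 (c%:MP : {mpoly K[n]}).
Proof.
move=> m; rewrite mcoeff_msupp mcoeffC.
by have [->|_] := eqVneq m 0%MM; rewrite ?mdeg0 // mulr0 eqxx.
Qed.

Lemma homog_degZ d (c : K) p : homog_deg d p -> homog_deg d (c *: p).
Proof. by move=> h m /msuppZ_le /h. Qed.

Definition homog_part (d : int) p : {mpoly K[n]} :=
  mpoly_of_coef (msupp p) (fun m => if (mdeg m)%:Z == d then p@_m else 0).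

Lemma mcoeff_homog_part d p m :
  (homog_part d p)@_m = if (mdeg m)%:Z == d then p@_m else 0.
Proof.
by apply: mcoeff_mpoly_of_coef => m'; case: ifP => _; rewrite ?eqxx // mcoeff_msupp.
Qed.

Lemma homog_part_homog d p : homog_deg d (homog_part d p).
Proof. by move=> m; rewrite mcoeff_msupp mcoeff_homog_part; case: ifP => [/eqP //|_]; rewrite eqxx. Qed.

Lemma homog_part_rest d p m : m \in msupp (p - homog_part d p) -> (mdeg m)%:Z <> d.
Proof.
rewrite mcoeff_msupp mcoeffB mcoeff_homog_part.
by case: ifP => [_|/eqP //]; rewrite subrr eqxx.
Qed.

End Polynomials.

(** * Comparison of graded free resolutions of K *)

Section Lifting.
Variables (K : fieldType) (n : nat).
Implicit Types (F G : free_resolution K n).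

Definition homog_mx (a b : nat) (e : 'I_a -> int) (f : 'I_b -> int)
  (M : 'M[{mpoly K[n]}]_(a, b)) := forall r c, homog_deg (e r - f c) (M r c).

Lemma homog_mulmx a b c (e : 'I_a -> int) (f : 'I_b -> int) (g : 'I_c -> int) M N :
  homog_mx e f M -> homog_mx f g N -> homog_mx e g (M *m N).
Proof.
move=> hM hN r s; rewrite mxE; apply: homog_deg_sum => t _.
rewrite (_ : e r - g s = (e r - f t) + (f t - g s)); last by ring.
exact: homog_degM.
Qed.

Lemma homog_mxB a b (e : 'I_a -> int) (f : 'I_b -> int) M N :
  homog_mx e f M -> homog_mx e f N -> homog_mx e f (M - N).
Proof. by move=> hM hN r s; rewrite !mxE; apply: homog_degB. Qed.

(** Because [N] is homogeneous, products with the components of [W] of the wrong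
degree have no term in the degree of [M]; those components may be dropped. *)
Lemma homog_mx_factor a b c (e : 'I_a -> int) (f : 'I_b -> int) (g : 'I_c -> int)
    M W N :
  homog_mx e g M -> homog_mx f g N -> M = W *m N ->
  exists2 W', homog_mx e f W' & M = W' *m N.
Proof.
move=> hM hN MW; pose W' := \matrix_(r, s) homog_part (e r - f s) (W r s).
have hW' : homog_mx e f W' by move=> r s; rewrite mxE; apply: homog_part_homog.
exists W' => //; apply/eqP; rewrite -subr_eq0; apply/eqP/matrixP => r s.
apply/mpolyP => m; rewrite [in RHS]mxE mcoeff0; apply/eqP; apply: contraT.
rewrite -mcoeff_msupp => mM.
have := homog_mxB hM (homog_mulmx hW' hN) mM.
move: mM; rewrite MW -mulmxBl mxE => /msupp_sum_ex [t _].
move=> /msuppM_split [m1 [m2 [h1 /hN h2 ->]]].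
move: h1; rewrite !mxE => /homog_part_rest h1.
by rewrite mdegD PoszD h2 => h3; case: h1; move: h3; lia.
Qed.

Definition augm F (v : 'rV[{mpoly K[n]}]_(fr_rank F 0)) : K :=
  \sum_b (v 0 b)@_0%MM * fr_aug b.

Definition is_exact_row F (i : nat) : 'rV[{mpoly K[n]}]_(fr_rank F i) -> Prop :=
  match i with
  | 0 => fun v => augm v = 0
  | i'.+1 => fun v => v *m fr_diff F i' = 0
  end.

Lemma exact_rowP F i (v : 'rV_(fr_rank F i)) :
  is_exact_row v <-> exists w, v = w *m fr_diff F i.
Proof. case: i v => [|i] v; [exact: fr_exact0 | exact: fr_exactS]. Qed.

Lemma exact_row_closed F i (v : 'rV_(fr_rank F i)) : is_exact_row v -> tor_closed v.
Proof. by case: i v. Qed.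

(** This is the lifting property of free modules, applied to the rows of [M]. *)
Lemma lift_mx G i a (e : 'I_a -> int) (M : 'M_(a, fr_rank G i)) :
  homog_mx e (@fr_deg _ _ G i) M -> (forall r, is_exact_row (row r M)) ->
  exists2 W, homog_mx e (@fr_deg _ _ G i.+1) W & M = W *m fr_diff G i.
Proof.
move=> hM /(_ _)/exact_rowP exM.
have exW r : {w | row r M = w *m fr_diff G i}.
  by apply: constructive_indefinite_description.
apply: (@homog_mx_factor _ _ _ _ _ _ _ (\matrix_r sval (exW r))) => //.
  exact: fr_diff_homog.
by apply/row_matrixP => r; rewrite row_mul rowK; case: (exW r).
Qed.

(** A matrix at level [i] is accepted when it is the top of a tower of matrices
commuting with the differentials, so that no infinite family of matrices over
[i] has to be carried around. *)
Fixpoint chain_map F G i : 'M[{mpoly K[n]}]_(fr_rank F i, fr_rank G i) -> Prop :=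
  match i with
  | 0 => fun phi => homog_mx (@fr_deg _ _ F 0) (@fr_deg _ _ G 0) phi /\
                    forall v, augm (v *m phi) = augm v
  | i'.+1 => fun phi => homog_mx (@fr_deg _ _ F i'.+1) (@fr_deg _ _ G i'.+1) phi /\
      exists psi, chain_map psi /\ fr_diff F i' *m psi = phi *m fr_diff G i'
  end.

Lemma chain_map_homog F G i (phi : 'M_(fr_rank F i, fr_rank G i)) :
  chain_map phi -> homog_mx (@fr_deg _ _ F i) (@fr_deg _ _ G i) phi.
Proof. by case: i phi => [|i] phi []. Qed.

Lemma chain_map_exact F G i (phi : 'M_(fr_rank F i, fr_rank G i)) v :
  chain_map phi -> is_exact_row v -> is_exact_row (v *m phi).
Proof.
case: i phi v => [|i] phi v [_] /= => [-> //| [psi [_ e]]] v0.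
by rewrite -mulmxA -e mulmxA v0 mul0mx.
Qed.

Lemma chain_map_closed F G i (phi : 'M_(fr_rank F i, fr_rank G i)) v :
  chain_map phi -> tor_closed v -> tor_closed (v *m phi).
Proof. by case: i phi v => [//|i] phi v; apply: chain_map_exact. Qed.

Lemma diff_exact_row F i r : is_exact_row (row r (fr_diff F i)).
Proof. by apply/exact_rowP; exists (delta_mx 0 r); rewrite -rowE. Qed.

Lemma chain_mapS F G i (phi : 'M_(fr_rank F i, fr_rank G i)) :
  chain_map phi ->
  exists2 phi' : 'M_(fr_rank F i.+1, fr_rank G i.+1),
    chain_map phi' & fr_diff F i *m phi = phi' *m fr_diff G i.
Proof.
move=> cphi.
have [||W hW e] := @lift_mx G i _ (@fr_deg _ _ F i.+1) (fr_diff F i *m phi).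
- by apply: homog_mulmx (chain_map_homog cphi); apply: fr_diff_homog.
- by move=> r; rewrite row_mul; apply: chain_map_exact => //; apply: diff_exact_row.
by exists W => //; split=> //; exists phi.
Qed.

(** At level 0, a basis element of augmentation [c] goes to a multiple of one
basis element of [G] with nonzero augmentation; both sit in degree 0. *)
Lemma chain_map_ex F G i : exists phi : 'M_(fr_rank F i, fr_rank G i), chain_map phi.
Proof.
elim: i => [|i [phi /chain_mapS [phi' ? _]]]; last by exists phi'.
have [b0 ab0] := fr_aug_surj G.
exists (\matrix_(a, b) (if b == b0 then fr_aug a / fr_aug b0 else 0)%:MP); split.
  move=> a b; rewrite mxE; case: eqP => [->|_]; last by rewrite mpolyC0; apply: homog_deg0.
  have [->|a0] := eqVneq (fr_aug a) 0; first by rewrite mul0r mpolyC0; apply: homog_deg0.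
  by rewrite (fr_aug_homog a0) (fr_aug_homog ab0); apply: homog_degC.
move=> v; rewrite /augm (bigD1 b0) //= big1 => [|b /negPf bb0]; last first.
  by rewrite mxE big1 ?mcoeff0 ?mul0r // => a _; rewrite mxE bb0 mpolyC0 mulr0.
rewrite addr0 mxE raddf_sum mulr_suml; apply: eq_bigr => a _ /=.
by rewrite mxE eqxx [v 0 a * _]mulrC mul_mpolyC mcoeffZ mulrAC divfK // mulrC.
Qed.

Lemma chain_map_comp F G H i (phi : 'M_(fr_rank F i, fr_rank G i))
   (psi : 'M_(fr_rank G i, fr_rank H i)) :
  chain_map phi -> chain_map psi -> chain_map (phi *m psi).
Proof.
elim: i phi psi => [|i IH] phi psi [hphi cphi] [hpsi cpsi]; split;
  try exact: homog_mulmx hpsi.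
  by move=> v; rewrite mulmxA cpsi cphi.
have [[phi0 [c1 e1]] [psi0 [c2 e2]]] := (cphi, cpsi).
exists (phi0 *m psi0); split; first exact: IH.
by rewrite mulmxA e1 -!mulmxA e2.
Qed.

Lemma chain_map_id F i : @chain_map F F i 1%:M.
Proof.
have h1 j : homog_mx (@fr_deg _ _ F j) (@fr_deg _ _ F j) 1%:M.
  move=> a b; rewrite mxE; case: eqP => [->|_] /=; last exact: homog_deg0.
  by rewrite subrr -mpolyC1; apply: homog_degC.
elim: i => [|i IH]; split=> //; first by move=> v; rewrite mulmx1.
by exists 1%:M; rewrite mulmx1 mul1mx.
Qed.

(** The usual homotopy identity has a second term that starts with the
differential of [F]; it vanishes on closed rows, which are the only ones that
matter for homology. *)
Lemma chain_map_homotopy F G i (phi phi' : 'M_(fr_rank F i, fr_rank G i)) :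
  chain_map phi -> chain_map phi' ->
  exists2 h, homog_mx (@fr_deg _ _ F i) (@fr_deg _ _ G i.+1) h &
    forall v, tor_closed v -> v *m phi - v *m phi' = v *m h *m fr_diff G i.
Proof.
elim: i phi phi' => [|i IH] phi phi'.
  move=> [h1 c1] [h2 c2].
  have [||h hh e] := @lift_mx G 0 _ (@fr_deg _ _ F 0) (phi - phi').
  - exact: homog_mxB.
  - move=> r /=; rewrite rowE mulmxBr.
    have augB u v : augm (u - v) = augm u - augm v.
      by rewrite /augm -sumrB; apply: eq_bigr => b _; rewrite !mxE mcoeffB mulrBl.
    by rewrite augB c1 c2 subrr.
  by exists h => // v _; rewrite -mulmxBr e mulmxA.
move=> [h1 [psi [c1 e1]]] [h2 [psi' [c2 e2]]].
have [h hh e] := IH _ _ c1 c2.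
have [||h' hh' e'] :=
    @lift_mx G i.+1 _ (@fr_deg _ _ F i.+1) (phi - phi' - fr_diff F i *m h).
- do 2?[apply: homog_mxB => //]; apply: homog_mulmx hh; exact: fr_diff_homog.
- move=> r /=; rewrite -row_mul !mulmxBl -e1 -e2.
  have cr : tor_closed (row r (fr_diff F i)).
    exact/exact_row_closed/diff_exact_row.
  by rewrite !linearB /= !row_mul (e _ cr) subrr.
exists h' => // v /= v0.
by rewrite -mulmxA -e' !mulmxBr (mulmxA v (fr_diff F i)) v0 mul0mx subr0.
Qed.
End Lifting.
(** * Independence of Tor from the resolution *)

Section TorInvariance.
Variables (K : fieldType) (n : nat).
Implicit Types (F G : free_resolution K n) (I : {mpoly K[n]} -> Prop).

Definition is_ideal I :=
  [/\ I 0, forall p q, I p -> I q -> I (p + q) & forall p q, I p -> I (p * q)].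

Section Ideal.
Variable I : {mpoly K[n]} -> Prop.
Hypothesis idI : is_ideal I.

Lemma ideal_sum (J : Type) (r : seq J) (P : pred J) (f : J -> {mpoly K[n]}) :
  (forall j, P j -> I (f j)) -> I (\sum_(j <- r | P j) f j).
Proof. by case: idI => I0 ID _ h; elim/big_rec: _ => // j p /h; apply: ID. Qed.

Lemma idealMl p q : I q -> I (p * q).
Proof. by case: idI => _ _ IM; rewrite mulrC; apply: IM. Qed.

Lemma tensor_comp_mul F G i k (M : 'M_(fr_rank F i, fr_rank G k)) d v :
  homog_mx (@fr_deg _ _ F i) (@fr_deg _ _ G k) M ->
  tensor_comp I d v -> tensor_comp I d (v *m M).
Proof.
move=> hM hv b; split; rewrite mxE.
  by apply: ideal_sum => a _; case: idI => _ _; apply; case: (hv a).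
apply: homog_deg_sum => a _.
rewrite (_ : d - fr_deg b = (d - fr_deg a) + (fr_deg a - fr_deg b)); last by ring.
by apply: homog_degM (hM _ _); case: (hv a).
Qed.

Lemma tensor_comp0 F i d : @tensor_comp K n F I i d 0.
Proof. by move=> b; rewrite mxE; split; [case: idI | apply: homog_deg0]. Qed.

Lemma tensor_compD F i d u v :
  @tensor_comp K n F I i d u -> tensor_comp I d v -> tensor_comp I d (u + v).
Proof.
move=> hu hv b; have [[iu du] [iv dv]] := (hu b, hv b).
by rewrite mxE; split; [case: idI => _ ID _; apply: ID | apply: homog_degD].
Qed.

Lemma tensor_compZ F i d (c : K) v :
  @tensor_comp K n F I i d v -> tensor_comp I d (c%:MP *: v).
Proof.
move=> hv b; have [iv dv] := hv b.
by rewrite mxE; split; [apply: idealMl | rewrite mul_mpolyC; apply: homog_degZ].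
Qed.

Lemma tor_boundary0 F i d : @tor_boundary K n F I i d 0.
Proof. by exists 0; split; [apply: tensor_comp0 | rewrite mul0mx]. Qed.

Lemma tor_boundaryD F i d u v :
  @tor_boundary K n F I i d u -> tor_boundary I d v -> tor_boundary I d (u + v).
Proof.
move=> [w [hw ->]] [w' [hw' ->]]; exists (w + w').
by rewrite mulmxDl; split => //; apply: tensor_compD.
Qed.

Lemma tor_boundaryZ F i d (c : K) v :
  @tor_boundary K n F I i d v -> tor_boundary I d (c%:MP *: v).
Proof.
move=> [w [hw ->]]; exists (c%:MP *: w).
by rewrite scalemxAl; split => //; apply: tensor_compZ.
Qed.

Lemma tor_boundaryN F i d v :
  @tor_boundary K n F I i d v -> tor_boundary I d (- v).
Proof. by move/(tor_boundaryZ (-1)); rewrite mpolyCN mpolyC1 scaleN1r. Qed.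

Lemma tor_boundary_sum F i d (r : nat) (v : 'I_r -> 'rV_(fr_rank F i)) (c : 'I_r -> K) :
  (forall k, tor_boundary I d (v k)) -> tor_boundary I d (\sum_k (c k)%:MP *: v k).
Proof.
move=> h; elim/big_rec: _ => [|k x _]; first exact: tor_boundary0.
by apply: tor_boundaryD; apply: tor_boundaryZ.
Qed.

Lemma tor_cycle_sum F i d (r : nat) (v : 'I_r -> 'rV_(fr_rank F i)) (c : 'I_r -> K) :
  (forall k, tor_cycle I d (v k)) -> tor_cycle I d (\sum_k (c k)%:MP *: v k).
Proof.
move=> h; split.
  elim/big_rec: _ => [|k x _]; first exact: tensor_comp0.
  by apply: tensor_compD; apply: tensor_compZ; case: (h k).
case: i v h => [//|i] v h /=.
by rewrite mulmx_suml big1 // => k _; rewrite -scalemxAl; case: (h k) => _ /= ->; rewrite scaler0.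
Qed.

Lemma chain_map_boundary F G i (phi : 'M_(fr_rank F i, fr_rank G i)) d v :
  chain_map phi -> tor_boundary I d v -> tor_boundary I d (v *m phi).
Proof.
move=> /chain_mapS [phi' /chain_map_homog hphi' e] [w [hw ->]].
exists (w *m phi'); split; first exact: tensor_comp_mul.
by rewrite -!mulmxA e.
Qed.

(** A linear relation modulo boundaries between the images of the cycles in [G]
pulls back along a chain map [G] to [F], because the composite [F] to [F] is
homotopic to the identity.  Hence the induced map on homology is injective. *)
Lemma tor_dim_le F G i d r r' :
  @tor_dim K n F I i d r -> @tor_dim K n G I i d r' -> (r <= r')%N.
Proof.
move=> [z [cz uz]] [z' [cz' uz']].
have [phi cphi] := chain_map_ex F G i.
have [psi cpsi] := chain_map_ex G F i.
have cphiz k : tor_cycle I d (z k *m phi).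
  have [h1 h2] := cz k; split; last exact: chain_map_closed.
  exact: tensor_comp_mul (chain_map_homog cphi) h1.
have exC k : {c : 'rV[K]_r' |
    tor_boundary I d (z k *m phi - \sum_l (c 0 l)%:MP *: z' l)}.
  apply: constructive_indefinite_description.
  by have [c [hc _]] := uz' _ (cphiz k); exists c.
pose C := \matrix_(k, l) (sval (exC k)) 0 l.
(* With more cycles than coordinates, some combination [a] of the coordinate rows
   is zero. *)
rewrite leqNgt; apply/negP => lt_r.
have /rowV0Pn [a /sub_kermxP aC a0] : kermx C != 0.
  by rewrite kermx_eq0 /row_free neq_ltn (leq_ltn_trans (rank_leq_col C) lt_r).
pose y := \sum_k (a 0 k)%:MP *: z k.
have cy : tor_cycle I d y by apply: tor_cycle_sum.
have byphi : tor_boundary I d (y *m phi).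
  have : tor_boundary I d (\sum_k (a 0 k)%:MP *:
       (z k *m phi - \sum_l (C k l)%:MP *: z' l)).
    apply: tor_boundary_sum => k; under eq_bigr => l _ do rewrite mxE.
    exact: svalP (exC k).
  under eq_bigr => k _ do rewrite scalerBr scaler_sumr scalemxAl.
  rewrite sumrB -mulmx_suml exchange_big /= [X in _ - X]big1 ?subr0 // => l _.
  under eq_bigr => k _ do rewrite scalerA -mpolyCM.
  rewrite -scaler_suml -raddf_sum /=.
  have /rowP/(_ l) := aC; rewrite !mxE => ->.
  by rewrite mpolyC0 scale0r.
have [h hh /(_ y (proj2 cy))] :=
  chain_map_homotopy (chain_map_comp cphi cpsi) (chain_map_id F i).
rewrite mulmx1 mulmxA => ey.
have : tor_boundary I d y.
  rewrite -(subKr (y *m phi *m psi) y); apply: tor_boundaryD.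
    exact: chain_map_boundary.
  apply: tor_boundaryN; rewrite ey; exists (y *m h); split=> //.
  exact: tensor_comp_mul hh (proj1 cy).
move=> bdy; have c0 : tor_cycle I d (0 : 'rV_(fr_rank F i)).
  split; first exact: tensor_comp0.
  by case: (i) => //= j; rewrite mul0mx.
have [c [_ uc]] := uz _ c0.
have := uc 0; rewrite [X in _ - X]big1 => [|k _]; last by rewrite mxE mpolyC0 scale0r.
rewrite subr0 => /(_ (tor_boundary0 F i d)) c_0.
have := uc (- a); rewrite sub0r -sumrN.
under eq_bigr => k _ do rewrite mxE mpolyCN scaleNr opprK.
by move=> /(_ bdy) ca; case/eqP: a0; rewrite -[a]opprK -ca c_0 oppr0.
Qed.

End Ideal.

Lemma betti_eq I F i d r :
  is_ideal I -> @tor_dim K n F I i d r -> betti I i d = r.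
Proof.
move=> idI h; rewrite /betti.
have [G hG] := epsilon_spec (inhabits 0%N) (fun r => exists F, @tor_dim K n F I i d r)
   (ex_intro _ r (ex_intro _ F h)).
by apply/eqP; rewrite eqn_leq (tor_dim_le idI hG h) (tor_dim_le idI h hG).
Qed.

End TorInvariance.
(** * Signs and the contracting homotopy of the Koszul complex *)

Section KoszulSigns.
Variables (K : fieldType) (n : nat).
Implicit Types (s t : {set 'I_n}) (k l : 'I_n) (m a : 'X_{1..n}).

(** For k not in [s], the sign that reorders e_k e_s into the increasing product
over k |: s. *)
Definition ksign k s : K := (-1) ^+ #|[set l in s | (l < k)%N]|.

Lemma ksign_sqr k s : ksign k s * ksign k s = 1.
Proof. by rewrite -expr2 sqrr_sign. Qed.

Lemma ksignU1 k l s : l \notin s ->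
  ksign k (l |: s) = (if (l < k)%N then -1 else 1) * ksign k s.
Proof.
move=> ls; rewrite /ksign; case: ifP => lk.
  rewrite (_ : [set _ in _ | _] = l |: [set x in s | (x < k)%N]).
    by rewrite cardsU1 inE (negPf ls) exprS.
  by apply/setP => x; rewrite !inE; case: eqP => [->|_] //=; rewrite lk.
rewrite mul1r; congr (_ ^+ _); apply: eq_card => x; rewrite !inE.
by case: eqP => [->|//] /=; rewrite lk andbF.
Qed.

(** This is the anticommutation of contractions by e_k and e_l, in a form that
solves for one of the four signs. *)
Lemma ksign_swap k l s : k != l -> k \notin s -> l \notin s ->
  ksign k (l |: s) = - (ksign l (k |: s) * ksign k s * ksign l s).
Proof.
move=> kl ks ls; rewrite !ksignU1 //; move: (ksign k s) (ksign l s) (ksign_sqr l s).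
move=> x y yy; rewrite (_ : _ * y * x * y = (if (k < l)%N then -1 else 1) * x * (y * y)); last by ring.
rewrite yy mulr1; rewrite -val_eqE /= in kl.
by case: (ltngtP k l) kl => // _ _; rewrite ?mulN1r ?opprK ?mul1r.
Qed.

(** The exponent vector of the squarefree monomial x_s. *)
Definition mset s : 'X_{1..n} := [multinom (k \in s : nat) | k < n].
Definition msupport m : {set 'I_n} := [set k | 0 < m k]%N.

Lemma msetE s k : mset s k = (k \in s) :> nat.
Proof. exact: mnmE. Qed.

Lemma mset_in s k : k \in s -> mset s = (U_(k) + mset (s :\ k))%MM.
Proof.
move=> ks; apply/mnmP => l; rewrite mnmDE !msetE mnm1E !inE eq_sym.
by case: eqP => [->|] //=; rewrite ks.
Qed.

Lemma mset_out s k : k \notin s -> mset (k |: s) = (U_(k) + mset s)%MM.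
Proof. by move=> ks; rewrite (@mset_in _ k) ?setU11 // setU1K. Qed.

Lemma msupport_mset s : msupport (mset s) = s.
Proof. by apply/setP => k; rewrite inE msetE lt0b. Qed.

Lemma mdeg_mset s : mdeg (mset s) = #|s|.
Proof.
rewrite mdegE -sum1_card [RHS]big_mkcond /=.
by apply: eq_bigr => k _; rewrite msetE; case: (k \in s).
Qed.

Lemma multideg_up s m k : k \notin s -> (0 < m k)%N ->
  ((m - U_(k)) + mset (k |: s) = m + mset s)%MM.
Proof.
move=> ks mk; rewrite (mset_out ks) addmA submK //.
by rewrite lep1mP -lt0n.
Qed.

Implicit Types (f : {set 'I_n} -> 'X_{1..n} -> K).

(** The Koszul differential on coefficients: [f s m] is the coefficient of
e_s x^m, and x^m is divided by x_k when e_k is contracted. *)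
Definition diffc f s m : K :=
  \sum_(k | (k \notin s) && (0 < m k)%N) ksign k s * f (k |: s) (m - U_(k))%MM.

Section Homotopy.
Variable kappa : 'X_{1..n} -> option 'I_n.
Hypothesis kappa_gt0 : forall a k, kappa a = Some k -> (0 < a k)%N.

(** Exterior multiplication by e_k combined with division by x_k, where
k = kappa a is allowed to depend on the multidegree a = m + [mset s]. *)
Definition homotc f s m : K :=
  if kappa (m + mset s)%MM is Some k then
    if k \in s then ksign k (s :\ k) * f (s :\ k) (m + U_(k))%MM else 0
  else 0.

(** The differential preserves the multidegree, so within one multidegree the
homotopy uses a single index k.  The terms that contract a different index
cancel by anticommutation; contracting k itself gives back e_s x^m. *)
Lemma koszul_homotopy f s m : kappa (m + mset s)%MM != None ->
  diffc (homotc f) s m + homotc (diffc f) s m = f s m.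
Proof.
case ek: (kappa _) => [k|//] _.
have Ddh : diffc (homotc f) s m =
    \sum_(l | (l \notin s) && (0 < m l)%N && (k \in l |: s)) 
      ksign l s * (ksign k ((l |: s) :\ k) * f ((l |: s) :\ k) (m - U_(l) + U_(k))%MM).
  rewrite /diffc [RHS]big_mkcondr /=; apply: eq_bigr => l /andP [ls ml].
  by rewrite /homotc multideg_up // ek; case: ifP => // _; rewrite mulr0.
rewrite Ddh /homotc ek; case: (boolP (k \in s)) => ks; last first.
  have mk : (0 < m k)%N.
    by have := kappa_gt0 ek; rewrite mnmDE msetE (negPf ks) addn0.
  rewrite addr0 (big_pred1 k) => [|l]; last first.
    rewrite !inE (negPf ks) orbF /= (eq_sym k).
    by case: eqP => [->|]; rewrite ?ks ?mk ?andbF.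
  by rewrite mulrA setU1K // ksign_sqr mul1r submK // lep1mP -lt0n.
set u := s :\ k; have ku : k \notin u by rewrite !inE eqxx.
have us : s = k |: u by rewrite setD1K.
rewrite /diffc [X in _ + _ * X](bigD1 k) /=; last by rewrite ku mnmDE mnm1E eqxx addn1.
rewrite mulrDr mulrA ksign_sqr mul1r addmK -us addrCA -[RHS]addr0; congr (_ + _).
rewrite mulr_sumr (eq_bigl (fun l => [&& l \notin u, 0 < (m + U_(k))%MM l & l != k]%N)); last first.
  move=> l; rewrite mnmDE mnm1E (_ : (l \notin s) = (l != k) && (l \notin u)).
    by rewrite in_setU1 ks orbT; case: (eqVneq k l); rewrite ?andbF //= addn0 !andbT.
  by rewrite us in_setU1 negb_or.
under [X in _ + X]eq_bigl => l do rewrite -andbA.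
rewrite -big_split big1 //= => l /and3P [lu ml lk].
have ls : l \notin s by rewrite us in_setU1 negb_or lk.
have ml' : (0 < m l)%N by move: ml; rewrite mnmDE mnm1E eq_sym (negPf lk) addn0.
have -> : (l |: s) :\ k = l |: u.
  by apply/setP => x; rewrite !inE; case: (eqVneq x k) => [->|] //=; rewrite eq_sym (negPf lk).
have -> : (m - U_(l) + U_(k) = m + U_(k) - U_(l))%MM.
  by apply/mnmP => x; rewrite !(mnmDE, mnmBE) !mnm1E; case: (eqVneq l x) => [<-|]; lia.
rewrite !mulrA -mulrDl; apply/eqP; rewrite mulf_eq0; apply/orP; left.
rewrite (ksign_swap _ ku lu) 1?eq_sym // -us mulrN !mulrA ksign_sqr mul1r.
by rewrite addrC subrr.
Qed.

End Homotopy.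

End KoszulSigns.
(** * The Koszul complex as a free resolution *)

Section KoszulComplex.
Variables (K : fieldType) (n : nat).
Implicit Types (s t : {set 'I_n}) (k l : 'I_n) (m a : 'X_{1..n}).
Implicit Types (f : {set 'I_n} -> 'X_{1..n} -> K).

Lemma sum_antisym (A : 'I_n -> 'I_n -> K) :
  (forall k, A k k = 0) -> (forall k l, k != l -> A k l = - A l k) ->
  \sum_k \sum_l A k l = 0.
Proof.
move=> A0 AN.
pose B k l := if (k < l)%N then A k l else 0.
have AB k l : A k l = B k l - B l k.
  rewrite /B; case: (ltngtP k l) => [kl|lk|/val_inj ->]; rewrite ?subr0 ?sub0r ?A0 //.
  by apply: AN; rewrite -val_eqE /= gtn_eqF.
under eq_bigr => k _ do under eq_bigr => l _ do rewrite AB.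
under eq_bigr => k _ do rewrite sumrB.
by rewrite sumrB [X in _ - X]exchange_big /= subrr.
Qed.

Lemma diffc_diffc f s m : diffc (diffc f) s m = 0.
Proof.
pose A k l := if [&& k \notin s, l \notin s, k != l, 0 < m k & 0 < m l]%N then
  ksign K k s * ksign K l (k |: s) * f (l |: (k |: s)) (m - U_(k) - U_(l))%MM else 0.
rewrite -[RHS](@sum_antisym A) => [|k|k l kl]; last first.
- rewrite /A (eq_sym l) !andbA [(l \notin s) && _]andbC.
  rewrite -!andbA [(0 < m l)%N && _]andbC; case: ifP => [|_]; last by rewrite oppr0.
  move=> /and5P [ks ls _ mk ml]; rewrite setUCA submDA addmC -submDA -mulNr.
  congr (_ * _); rewrite (ksign_swap K kl ks ls) mulrN opprK.
  move: (ksign K k s) (ksign K l _) (ksign K l s) (ksign_sqr K l s) => x z y yy.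
  by transitivity (x * z * (y * y)); [rewrite yy mulr1 | ring].
- by rewrite /A eqxx /= !andbF.
rewrite /diffc big_mkcond /=; apply: eq_bigr => k _.
case: ifP => [/andP [ks mk]|kF]; last first.
  rewrite big1 // => l _; rewrite /A; case: ifP => // /and5P [ks _ _ mk _].
  by rewrite ks mk in kF.
rewrite big_mkcond mulr_sumr; apply: eq_bigr => l _ /=.
rewrite /A ks mk /= in_setU1 negb_or mnmBE mnm1E (eq_sym k l).
case: (eqVneq l k) => [_|_] /=; first by rewrite mulr0 andbF.
by rewrite subn0; case: ifP => _; rewrite ?mulr0 // mulrA.
Qed.

Definition kbase (i : nat) : {set {set 'I_n}} := [set s : {set 'I_n} | #|s| == i].
Definition krank i : nat := #|kbase i|.
Definition kset i (b : 'I_(krank i)) : {set 'I_n} := enum_val b.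

Lemma kset_card i (b : 'I_(krank i)) : #|kset b| = i.
Proof. by have := enum_valP b; rewrite inE => /eqP. Qed.

Lemma kset_eq i (b c : 'I_(krank i)) : (kset b == kset c) = (b == c).
Proof. by apply/eqP/eqP => [/enum_val_inj|->]. Qed.

Lemma kset_ex i s : #|s| = i -> exists b : 'I_(krank i), kset b = s.
Proof.
move=> si; have sb : s \in kbase i by rewrite inE si.
by exists (enum_rank_in sb s); rewrite /kset enum_rankK_in.
Qed.

(** Coefficients of a row of the Koszul complex.  The sum has at most one term, and
gives 0 when [s] does not have [i] elements. *)
Definition rowc i (v : 'rV[{mpoly K[n]}]_(krank i)) s m : K :=
  \sum_(b | kset b == s) (v 0 b)@_m.

Lemma rowc_kset i (v : 'rV_(krank i)) b m : rowc v (kset b) m = (v 0 b)@_m.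
Proof. by rewrite /rowc (big_pred1 b) // => c; rewrite /= kset_eq. Qed.

Lemma rowc_out i (v : 'rV_(krank i)) s m : #|s| <> i -> rowc v s m = 0.
Proof.
by move=> si; rewrite /rowc big1 // => b /eqP bs; case: si; rewrite -bs kset_card.
Qed.

Lemma rowc_inj i (u v : 'rV_(krank i)) :
  (forall s m, rowc u s m = rowc v s m) -> u = v.
Proof.
move=> uv; apply/rowP => b; apply/mpolyP => m.
by rewrite -!rowc_kset uv.
Qed.

Lemma rowcD i (u v : 'rV_(krank i)) s m : rowc (u + v) s m = rowc u s m + rowc v s m.
Proof. by rewrite /rowc -big_split; apply: eq_bigr => b _; rewrite mxE mcoeffD. Qed.

Lemma rowcB i (u v : 'rV_(krank i)) s m : rowc (u - v) s m = rowc u s m - rowc v s m.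
Proof. by rewrite /rowc -sumrB; apply: eq_bigr => b _; rewrite !mxE mcoeffB. Qed.

Lemma rowcZ i (c : K) (v : 'rV_(krank i)) s m :
  rowc (c%:MP *: v) s m = c * rowc v s m.
Proof.
by rewrite /rowc mulr_sumr; apply: eq_bigr => b _; rewrite mxE mcoeffCM.
Qed.

Lemma rowc0 i s m : @rowc i 0 s m = 0.
Proof. by rewrite /rowc big1 // => b _; rewrite mxE mcoeff0. Qed.

Lemma rowc_sum i (r : nat) (v : 'I_r -> 'rV_(krank i)) s m :
  rowc (\sum_k v k) s m = \sum_k rowc (v k) s m.
Proof.
by elim/big_ind2: _ => [|u x v' y <- <-|//]; rewrite ?rowc0 ?rowcD.
Qed.

Definition kdiff i : 'M[{mpoly K[n]}]_(krank i.+1, krank i) :=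
  \matrix_(c, b) \sum_(k | (k \notin kset b) && (kset c == k |: kset b))
     ksign K k (kset b) *: 'X_k.

Lemma mcoeffMXU k (p : {mpoly K[n]}) m :
  (p * 'X_k)@_m = if (0 < m k)%N then p@_(m - U_(k)) else 0.
Proof.
case: ifP => mk; last first.
  apply/eqP; rewrite mcoeff_eq0; apply/negP => /msuppM_split [m1 [m2 [_ h2 e]]].
  move: h2 mk; rewrite msuppX inE e => /eqP ->.
  by rewrite mnmDE mnm1E eqxx addn1.
by rewrite -(mcoeffMX p U_(k)) addmC submK // lep1mP -lt0n.
Qed.

Lemma rowc_diff i (v : 'rV_(krank i.+1)) s m :
  rowc (v *m kdiff i) s m = diffc (rowc v) s m.
Proof.
have [si|si] := eqVneq #|s| i; last first.
  rewrite rowc_out; last exact/eqP.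
  rewrite /diffc big1 // => k /andP [ks _].
  by rewrite rowc_out ?mulr0 // cardsU1 ks => -[/eqP]; rewrite (negPf si).
have [b <-] := kset_ex si.
rewrite rowc_kset mxE raddf_sum /=.
under eq_bigr => c _.
  rewrite mxE mulr_sumr raddf_sum /=.
  under eq_bigr => k _ do rewrite -scalerAr mcoeffZ mcoeffMXU.
  rewrite big_mkcondr /=.
over.
rewrite exchange_big /= /diffc [RHS]big_mkcondr /=; apply: eq_bigr => k kb.
rewrite -big_mkcond /=; case: ifP => mk; last by rewrite big1 // => c _; rewrite mulr0.
by rewrite /rowc mulr_sumr.
Qed.

(** The operation [homotc] on rows; the list is a bound for the support. *)
Definition khomot (kappa : 'X_{1..n} -> option 'I_n) i
    (v : 'rV[{mpoly K[n]}]_(krank i)) : 'rV[{mpoly K[n]}]_(krank i.+1) :=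
  \row_b mpoly_of_coef
    (flatten [seq [seq (m - U_(k))%MM | m <- msupp (\sum_(c | kset c == kset b :\ k) v 0 c)]
             | k <- enum 'I_n])
    (homotc kappa (rowc v) (kset b)).

Lemma rowc_homot kappa i (v : 'rV_(krank i)) s m :
  rowc (khomot kappa v) s m = homotc kappa (rowc v) s m.
Proof.
have [si|si] := eqVneq #|s| i.+1; last first.
  rewrite rowc_out; last exact/eqP.
  rewrite /homotc; case: (kappa _) => // k; case: ifP => // ks.
  rewrite rowc_out ?mulr0 // => e; move: si; rewrite (cardsD1 k) ks e.
  by rewrite add1n eqxx.
have [b <-] := kset_ex si.
rewrite rowc_kset mxE mcoeff_mpoly_of_coef // => m'.
rewrite /homotc; case: (kappa _) => [k|]; last by rewrite eqxx.
case: ifP => [kb|]; last by rewrite eqxx.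
rewrite mulf_eq0 negb_or => /andP [_ h].
apply/flatten_mapP; exists k; first by rewrite mem_enum.
apply/mapP; exists (m' + U_(k))%MM; last by rewrite addmK.
by rewrite mcoeff_msupp raddf_sum.
Qed.

Lemma diffc_closed i (v : 'rV_(krank i)) :
  (match i return 'rV[{mpoly K[n]}]_(krank i) -> Prop with
   | 0 => fun _ => True | j.+1 => fun v => v *m kdiff j = 0 end) v ->
  forall s m, diffc (rowc v) s m = 0.
Proof.
case: i v => [|i] v hv s m; last by rewrite -rowc_diff hv rowc0.
rewrite /diffc big1 // => k /andP [ks _].
by rewrite rowc_out ?mulr0 // cardsU1 ks.
Qed.

Lemma kappa_pickP j a k : [pick k : 'I_n | (j < a k)%N] = Some k -> (0 < a k)%N.
Proof. by case: pickP => // x xa [<-]; apply: leq_trans xa. Qed.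

(** Every nonzero multidegree has a positive coordinate to which the homotopy
applies.  Multidegree 0 only occurs for s = set0 and m = 0, where [v] is assumed
to vanish. *)
Lemma kdiff_exact i (v : 'rV_(krank i)) :
  (forall s m, diffc (rowc v) s m = 0) -> rowc v set0 0%MM = 0 ->
  v = khomot (fun a => [pick k | (0 < a k)%N]) v *m kdiff i.
Proof.
move=> dv v0; apply: rowc_inj => s m; rewrite rowc_diff.
set kappa := fun a => _.
have eh s' m' : rowc (khomot kappa v) s' m' = homotc kappa (rowc v) s' m'.
  exact: rowc_homot.
have -> : diffc (rowc (khomot kappa v)) s m = diffc (homotc kappa (rowc v)) s m.
  by apply: eq_bigr => k _; rewrite eh.
have hd : homotc kappa (diffc (rowc v)) s m = 0.
  by rewrite /homotc; case: (kappa _) => // k; rewrite dv mulr0 if_same.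
case ek: (kappa (m + mset s)%MM) => [k|].
  rewrite -[LHS](@koszul_homotopy _ _ kappa) ?ek ?hd ?addr0 // => b l.
  exact: kappa_pickP.
move: ek; rewrite /kappa; case: pickP => // ms0 _.
have m0 : m = 0%MM.
  apply/mnmP => k; rewrite mnm0E; apply/eqP; rewrite -leqn0 leqNgt.
  by have := ms0 k; rewrite mnmDE addn_gt0 => /norP [].
have s0 : s = set0.
  apply/setP => k; rewrite inE; have := ms0 k.
  by rewrite mnmDE addn_gt0 msetE => /norP [_]; rewrite lt0b => /negPf.
rewrite s0 m0 v0; apply/esym; rewrite /diffc big1 // => k.
by rewrite mnm0E ltnn andbF.
Qed.

Lemma kdiff_homog i c b : homog_deg (i.+1%:Z - i%:Z) (kdiff i c b).
Proof.
rewrite mxE; apply: homog_deg_sum => k _.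
apply: homog_degZ => m; rewrite msuppX inE => /eqP ->.
by rewrite mdeg1; lia.
Qed.

Lemma kaug_homog (b : 'I_(krank 0)) : (1 : K) != 0 -> 0%:Z = 0.
Proof. by []. Qed.

Lemma kaug_surj : exists b : 'I_(krank 0), (1 : K) != 0.
Proof.
have [b _] := @kset_ex 0 set0 (cards0 _).
by exists b; rewrite oner_neq0.
Qed.

Lemma kdiff_exact0 (v : 'rV_(krank 0)) :
  \sum_b (v 0 b)@_0%MM * 1 = 0 <-> exists w, v = w *m kdiff 0.
Proof.
have -> : \sum_b (v 0 b)@_0%MM * 1 = rowc v set0 0%MM.
  rewrite /rowc; apply: eq_big => [b|b _]; last by rewrite mulr1.
  by rewrite -cards_eq0 kset_card.
split=> [v0|[w ->]].
  exists (khomot (fun a => [pick k | (0 < a k)%N]) v).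
  by apply: kdiff_exact => //; apply: diffc_closed.
rewrite rowc_diff /diffc big1 // => k.
by rewrite mnm0E ltnn andbF.
Qed.

Lemma kdiff_exactS i (v : 'rV_(krank i.+1)) :
  v *m kdiff i = 0 <-> exists w, v = w *m kdiff i.+1.
Proof.
split=> [v0|[w ->]].
  exists (khomot (fun a => [pick k | (0 < a k)%N]) v); apply: kdiff_exact.
    exact: diffc_closed.
  by rewrite rowc_out // cards0.
apply: rowc_inj => s m; rewrite rowc_diff rowc0 -[RHS](diffc_diffc (rowc w) s m).
by apply: eq_bigr => k _; rewrite rowc_diff.
Qed.

Definition koszul : free_resolution K n :=
  @FreeResolution K n krank (fun i _ => i%:Z) kdiff (fun _ => 1)
    kdiff_homog kaug_homog kaug_surj kdiff_exact0 kdiff_exactS.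

End KoszulComplex.
(** * Squarefree strands of the Koszul complex of a Stanley-Reisner ideal *)

Section StanleyReisner.
Variables (K : fieldType) (n : nat).
Implicit Types (s t : {set 'I_n}) (k l : 'I_n) (m a : 'X_{1..n}).
Implicit Types (f : {set 'I_n} -> 'X_{1..n} -> K) (D : {set {set 'I_n}}).

Definition down_closed D := forall s t, t \subset s -> s \in D -> t \in D.

Lemma mset_le s m : (mset s <= m)%MM = (s \subset msupport m).
Proof.
apply/mnm_lepP/subsetP => [h k ks | h k].
  by have := h k; rewrite msetE ks inE.
by rewrite msetE; case: (boolP (k \in s)) => // /h; rewrite inE.
Qed.

Lemma prod_mset s : \prod_(k in s) 'X_k = 'X_[mset s] :> {mpoly K[n]}.
Proof.
rewrite mpolyXE_id [LHS]big_mkcond; apply: eq_bigr => k _.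
by rewrite msetE; case: ifP; rewrite ?expr1 ?expr0.
Qed.

(** The monomials of a member are grouped by support: those with support [s] are
multiples of the generator x_s. *)
Lemma SR_idealP D (p : {mpoly K[n]}) : down_closed D ->
  SR_ideal D p <-> forall m, m \in msupp p -> msupport m \notin D.
Proof.
move=> dcD; split=> [[c ->] m|h].
  move=> /msupp_sum_ex [s sD]; rewrite prod_mset => /msuppM_split [m1 [m2 [_ h ->]]].
  apply: contra sD; apply: dcD; rewrite -mset_le.
  by move: h; rewrite msuppX inE => /eqP ->; apply: lem_addl.
exists (fun s => \sum_(m <- msupp p | msupport m == s) p@_m *: 'X_[m - mset s]).
rewrite {1}[p]mpolyE big_seq.
rewrite (partition_big (fun m => msupport m) (fun s => s \notin D)) /=; last by move=> m /h.
apply: eq_bigr => s _; rewrite prod_mset mulr_suml -big_seq_cond.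
apply: eq_bigr => m /eqP <-; rewrite -scalerAl -mpolyXD submK //.
by rewrite mset_le.
Qed.

Lemma SR_ideal_is_ideal D : is_ideal (SR_ideal (K := K) D).
Proof.
split.
- by exists (fun=> 0); rewrite big1 // => s _; rewrite mul0r.
- move=> p q [c ->] [e ->]; exists (fun s => c s + e s).
  by rewrite -big_split; apply: eq_bigr => s _; rewrite mulrDl.
- move=> p q [c ->]; exists (fun s => c s * q).
  by rewrite mulr_suml; apply: eq_bigr => s _; rewrite mulrAC.
Qed.

Local Notation face2 := ({set 'I_n} * {set 'I_n})%type.
Local Notation V := {ffun face2 -> K^o}.
Implicit Types (u v w : V) (p : face2).

(** The Koszul differential on squarefree terms: [v (s, t)] is the coefficient of
e_s x_t. *)
Definition sqdiff_fun v : V :=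
  [ffun p : face2 => \sum_(k | (k \notin p.1) && (k \in p.2)) ksign K k p.1 * v (k |: p.1, p.2 :\ k)].

Fact sqdiff_is_linear : linear sqdiff_fun.
Proof.
move=> c u v; apply/ffunP => p; rewrite !ffunE /= scaler_sumr -big_split.
by apply: eq_bigr => k _; rewrite !ffunE mulrDr scalerAr.
Qed.
HB.instance Definition _ := GRing.isLinear.Build K V V *:%R sqdiff_fun sqdiff_is_linear.
Definition sqdiff : 'End(V) := linfun sqdiff_fun.

Definition restr_fun (P : pred face2) v : V :=
  [ffun p : face2 => if P p then v p else 0].
Fact restr_is_linear P : linear (restr_fun P).
Proof.
move=> c u v; apply/ffunP => p; rewrite !ffunE /=.
by case: ifP; rewrite ?scaler0 ?addr0.
Qed.
HB.instance Definition _ P :=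
  GRing.isLinear.Build K V V *:%R (restr_fun P) (restr_is_linear P).

Definition supported (P : pred face2) : {vspace V} :=
  limg (linfun (restr_fun P)).

Lemma supportedP (P : pred face2) v : reflect (forall p, v p != 0 -> P p) (v \in supported P).
Proof.
apply: (iffP memv_imgP) => [[w _ ->] p|h].
  by rewrite lfunE ffunE /=; case: ifP => //; rewrite eqxx.
exists v; rewrite ?memvf // lfunE; apply/ffunP => p; rewrite ffunE.
by case: ifP => // /negP pP; apply/eqP; apply: contraT => /h.
Qed.

(** The part of the Koszul complex of I_D of homological degree [i] and total degree
[d] spanned by squarefree terms e_s x_t; disjointness says that the multidegree
of e_s x_t is squarefree. *)
Definition strand D (i : nat) (d : int) : {vspace V} :=
  supported (fun p : face2 => [&& [disjoint p.1 & p.2], #|p.1| == i,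
                       (i + #|p.2|)%:Z == d & p.2 \notin D]).

Definition sqpart f : V :=
  [ffun p : face2 => if [disjoint p.1 & p.2] then f p.1 (mset p.2) else 0].

Lemma sqpart_diff f : sqdiff (sqpart f) = sqpart (diffc f).
Proof.
rewrite lfunE; apply/ffunP => -[s t]; rewrite !ffunE /=.
case: ifP => [st|/negbT].
  rewrite /diffc; apply: eq_big => k; first by rewrite msetE lt0b.
  move=> /andP [ks kt].
  rewrite ffunE /= ifT; last first.
    rewrite -setI_eq0 -subset0; apply/subsetP => x; rewrite !inE.
    case: eqP => //= _ /andP [xs xt].
    by have := disjointFr st xs; rewrite xt.
  congr (_ * f _ _); apply/mnmP => x; rewrite mnmBE !msetE mnm1E !inE eq_sym.
  by case: (eqVneq x k) => [->|_] /=; rewrite ?kt ?subn0.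
rewrite -setI_eq0 => /set0Pn [x]; rewrite inE => /andP [xs xt].
rewrite big1 // => k /andP [ks kt]; rewrite ffunE /= ifF ?mulr0 //.
apply/negP => /pred0P/(_ x) /=; rewrite !inE xs xt orbT andbT /=.
by case: eqP => // e; rewrite -e xs in ks.
Qed.

(** An index at which the multidegree fails to be squarefree, to be used in the
contracting homotopy. *)
Definition nonsqfree a : option 'I_n := [pick k | (1 < a k)%N].

Lemma nonsqfree_mset s t : [disjoint s & t] -> nonsqfree (mset t + mset s) = None.
Proof.
move=> st; rewrite /nonsqfree; case: pickP => // x.
rewrite mnmDE !msetE; case: (boolP (x \in s)) => [xs|]; last by case: (x \in t).
by rewrite (disjointFr st xs).
Qed.

Lemma nonsqfree_None s m : nonsqfree (m + mset s) = None ->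
  m = mset (msupport m) /\ [disjoint s & msupport m].
Proof.
rewrite /nonsqfree; case: pickP => // h _.
have h' k : (m k + (k \in s) <= 1)%N.
  by have := h k; rewrite mnmDE msetE ltnNge => /negbFE.
split; first by apply/mnmP => k; rewrite msetE inE; have := h' k; case: (m k) => [|[|]].
rewrite -setI_eq0 -subset0; apply/subsetP => k; rewrite !inE => /andP [ks mk].
by have := h' k; rewrite ks; lia.
Qed.

Definition embed i v : 'rV[{mpoly K[n]}]_(krank n i) :=
  \row_(b < krank n i) \sum_(t : {set 'I_n} | [disjoint kset b & t]) v (kset b, t) *: 'X_[mset t].

Lemma rowc_embed i v s m :
  rowc (embed i v) s m =
  if (#|s| == i) && (nonsqfree (m + mset s) == None) then v (s, msupport m) else 0.
Proof.
have [si|si] := eqVneq #|s| i; last by rewrite rowc_out //; apply/eqP.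
have [b <-] := kset_ex si.
rewrite rowc_kset mxE raddf_sum /=.
under eq_bigr => t _ do rewrite mcoeffZ mcoeffX.
case: eqP => [/nonsqfree_None [em dm]|nm]; last first.
  rewrite big1 // => t bt; case: eqP => [e|]; last by rewrite mulr0.
  by case: nm; rewrite -e nonsqfree_mset.
rewrite (bigD1 (msupport m)) //= -em eqxx mulr1 big1 ?addr0 // => t /andP [_ tm].
case: eqP => [e|]; last by rewrite mulr0.
by case/eqP: tm; rewrite -e msupport_mset.
Qed.

Lemma embed_diff i v : embed i (sqdiff v) = embed i.+1 v *m kdiff K n i.
Proof.
apply: rowc_inj => s m; rewrite rowc_diff rowc_embed.
have [si|si] /= := eqVneq #|s| i; last first.
  rewrite /diffc big1 // => k /andP [ks mk].
  by rewrite rowc_embed cardsU1 ks eqSS (negPf si) mulr0.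
case: eqP => [nm|/eqP nm]; last first.
  rewrite /diffc big1 // => k /andP [ks mk].
  by rewrite rowc_embed multideg_up // (negPf nm) andbF mulr0.
have [em dm] := nonsqfree_None nm.
rewrite lfunE ffunE /=; apply: eq_big => k; first by rewrite inE.
move=> /andP [ks]; rewrite inE => mk.
rewrite rowc_embed multideg_up // nm eqxx cardsU1 ks si eqxx /=.
congr (_ * v (_, _)); apply/setP => x; rewrite !inE mnmBE mnm1E eq_sym.
case: eqP => [<-|_] /=; last by rewrite subn0.
by rewrite em msetE; case: (_ \in _).
Qed.

Lemma rowc_embed_sqpart i (r : 'rV_(krank n i)) s m :
  rowc (embed i (sqpart (rowc r))) s m =
  if nonsqfree (m + mset s) == None then rowc r s m else 0.
Proof.
rewrite rowc_embed; have [si|si] /= := eqVneq #|s| i; last first.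
  by rewrite rowc_out ?if_same //; apply/eqP.
case: eqP => // /nonsqfree_None [em dm].
by rewrite ffunE /= dm -em.
Qed.

Lemma sqpart_embed D i d v : v \in strand D i d -> sqpart (rowc (embed i v)) = v.
Proof.
move=> /supportedP vX; apply/ffunP => -[s t]; rewrite ffunE /= rowc_embed.
have [v0|/vX /and4P [/= st -> _ _]] := eqVneq (v (s, t)) 0.
  by rewrite msupport_mset v0 !if_same.
by rewrite st nonsqfree_mset // msupport_mset.
Qed.

(** In a multidegree that is not squarefree the homotopy contracts; in a
squarefree one it is 0 and the two terms on the left agree. *)
Lemma sqpart_homotopy i (r : 'rV_(krank n i)) :
  (forall s m, diffc (rowc r) s m = 0) ->
  r - embed i (sqpart (rowc r)) = khomot nonsqfree r *m kdiff K n i.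
Proof.
move=> dr; apply: rowc_inj => s m; rewrite rowcB rowc_embed_sqpart rowc_diff.
have -> : diffc (rowc (khomot nonsqfree r)) s m = diffc (homotc nonsqfree (rowc r)) s m.
  by apply: eq_bigr => k _; rewrite rowc_homot.
have [e|e] := eqVneq (nonsqfree (m + mset s)) None.
  rewrite subrr /diffc big1 // => k /andP [ks mk].
  by rewrite /homotc multideg_up // e mulr0.
rewrite subr0 -[LHS](@koszul_homotopy _ _ nonsqfree _ _ _ _ e).
  rewrite [X in _ + X](_ : _ = 0) ?addr0 //.
  by rewrite /homotc; case: (nonsqfree _) => // k; rewrite dr mulr0 if_same.
by move=> a k; apply: kappa_pickP.
Qed.

Section Betti.
Variable D : {set {set 'I_n}}.
Hypothesis dcD : down_closed D.
Local Notation kos := (koszul K n).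
Local Notation I := (SR_ideal (K := K) D).

Lemma tensor_compP i d (r : 'rV_(krank n i)) :
  @tensor_comp K n kos I i d r <->
  forall s m, rowc r s m != 0 -> msupport m \notin D /\ (i + mdeg m)%:Z = d.
Proof.
split=> [h s m|h b].
  move=> rsm; have si : #|s| = i.
    by apply/eqP; apply: contraR rsm => /eqP si; rewrite rowc_out.
  have [b eb] := kset_ex si; move: rsm; rewrite -eb rowc_kset -mcoeff_msupp => mb.
  have [/(SR_idealP _ dcD)/(_ _ mb) ? /(_ _ mb) /= e] := h b; split=> //.
  by rewrite PoszD e; lia.
split; first apply/(SR_idealP _ dcD); move=> m;
  rewrite mcoeff_msupp -rowc_kset => /h [] //= _ <-.
by rewrite PoszD; lia.
Qed.

(** The homotopy divides by x_k only where the multidegree is at least 2 at [k].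
The quotient by x_k is then still divisible by x_k, so its support is unchanged
and it stays in I_D. *)
Lemma tensor_comp_homot i d (r : 'rV_(krank n i)) :
  @tensor_comp K n kos I i d r -> @tensor_comp K n kos I i.+1 d (khomot nonsqfree r).
Proof.
move=> /tensor_compP h; apply/tensor_compP => s m.
rewrite rowc_homot /homotc; case ek: (nonsqfree _) => [k|]; last by rewrite eqxx.
case: ifP => [ks|]; last by rewrite eqxx.
rewrite mulf_eq0 negb_or => /andP [_ /h [h1 h2]].
have mk : (0 < m k)%N.
  move: ek; rewrite /nonsqfree; case: pickP => // x; rewrite mnmDE msetE => hx [ex].
  by move: hx; rewrite ex ks; lia.
split; last by rewrite -h2 mdegD mdeg1; lia.
rewrite (_ : msupport m = msupport (m + U_(k))%MM) //.
apply/setP => x; rewrite !inE mnmDE mnm1E.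
by case: eqP => [<-|_]; rewrite ?addn0 // mk addn_gt0 mk.
Qed.

Lemma sqpart_strand i d (r : 'rV_(krank n i)) :
  @tensor_comp K n kos I i d r -> sqpart (rowc r) \in strand D i d.
Proof.
move=> /tensor_compP h; apply/supportedP => -[s t]; rewrite ffunE /=.
case: ifP => [st rst|]; last by rewrite eqxx.
have [] := h _ _ rst; rewrite msupport_mset mdeg_mset => -> ->.
rewrite eqxx /= andbT; apply: contraR rst => /eqP si.
by rewrite rowc_out.
Qed.

Lemma embed_tensor i d v :
  v \in strand D i d -> @tensor_comp K n kos I i d (embed i v).
Proof.
move=> /supportedP h; apply/tensor_compP => s m; rewrite rowc_embed.
case: ifP => [/andP [_ /eqP /nonsqfree_None [em _]]|]; last by rewrite eqxx.
by move=> /h /and4P [/= _ _ /eqP <- ->]; rewrite [in mdeg m]em mdeg_mset.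
Qed.

Lemma embed0 i : embed i 0 = 0.
Proof. by apply: rowc_inj => s m; rewrite rowc_embed rowc0 ffunE if_same. Qed.

Lemma embedD i u v : embed i (u + v) = embed i u + embed i v.
Proof.
apply: rowc_inj => s m; rewrite rowcD !rowc_embed ffunE.
by case: ifP => _ //; rewrite addr0.
Qed.

Lemma embedZ i (c : K) v : embed i (c *: v) = c%:MP *: embed i v.
Proof.
apply: rowc_inj => s m; rewrite rowcZ !rowc_embed ffunE.
by case: ifP => _ //; rewrite mulr0.
Qed.

Lemma embed_sum i (r : nat) (v : 'I_r -> V) : embed i (\sum_k v k) = \sum_k embed i (v k).
Proof. by apply: big_morph; [apply: embedD | apply: embed0]. Qed.

Lemma embed_closed i v : sqdiff v = 0 -> @tor_closed K n kos i (embed i v).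
Proof. by case: i => [//|i] v0; rewrite /tor_closed /= -embed_diff v0 embed0. Qed.

Lemma tor_closed_diffc i r : @tor_closed K n kos i r -> forall s m, diffc (rowc r) s m = 0.
Proof. exact: (@diffc_closed K n i r). Qed.

Lemma sqpartB_sum i (r : 'rV_(krank n i)) (q : nat) (c : 'I_q -> K) (z : 'I_q -> V) d :
  (forall k : 'I_q, z k \in strand D i d) ->
  sqpart (rowc (r - \sum_k (c k)%:MP *: embed i (z k))) =
  sqpart (rowc r) - \sum_k c k *: z k.
Proof.
move=> hz; apply/ffunP => -[s t]; rewrite !ffunE /= sum_ffunE rowcB rowc_sum.
have [st|st] := ifP.
  congr (_ - _); apply: eq_bigr => k _; rewrite rowcZ !ffunE /=; congr (_ * _).
  have /ffunP/(_ (s, t)) := sqpart_embed (hz k).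
  by rewrite ffunE /= st.
rewrite sub0r big1 ?oppr0 // => k _; rewrite ffunE (_ : z k (s, t) = 0) ?scaler0 //.
apply/eqP; apply: contraFT st => hk.
by have /supportedP/(_ _ hk)/and4P [] := hz k.
Qed.

Lemma sqdiff_strand i d v : v \in strand D i.+1 d -> sqdiff v \in strand D i d.
Proof.
move=> hv; rewrite -(sqpart_embed hv) sqpart_diff.
have -> : sqpart (diffc (rowc (embed i.+1 v))) =
    sqpart (rowc (embed i.+1 v *m kdiff K n i)).
  by apply/ffunP => p; rewrite !ffunE rowc_diff.
apply: sqpart_strand.
have := tensor_comp_mul (F := kos) (G := kos) (SR_ideal_is_ideal D) (M := kdiff K n i) _ (embed_tensor hv).
by apply => a b; apply: (fr_diff_homog (f := kos)).
Qed.

Lemma sqdiff_sqdiff i d v : v \in strand D i d -> sqdiff (sqdiff v) = 0.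
Proof.
move=> hv; rewrite -(sqpart_embed hv) !sqpart_diff; apply/ffunP => p.
by rewrite !ffunE diffc_diffc if_same.
Qed.

(** The homology of the strand at [i], by rank and nullity. *)
Definition strand_betti i d : nat :=
  \dim (strand D i d) - \dim (sqdiff @: strand D i d) - \dim (sqdiff @: strand D i.+1 d).

Lemma sqdiff_strands i d :
  (sqdiff @: strand D i.+1 d <= strand D i d :&: lker sqdiff)%VS.
Proof.
apply/subvP => w /memv_imgP [v hv ->]; rewrite memv_cap (sqdiff_strand hv).
by rewrite memv_ker (sqdiff_sqdiff hv) eqxx.
Qed.

Lemma strand_bettiE i d : strand_betti i d =
  \dim ((strand D i d :&: lker sqdiff) :\: (sqdiff @: strand D i.+1 d)).
Proof.
rewrite /strand_betti -(limg_ker_dim sqdiff (strand D i d)) addnK.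
rewrite -(dimv_cap_compl (strand D i d :&: lker sqdiff) (sqdiff @: strand D i.+1 d)).
by rewrite (capv_idPr (sqdiff_strands i d)) addKn.
Qed.

(** A basis of a complement of the boundaries in the cycles of the strand gives the
required cycles.  Taking squarefree parts transports boundaries back to the
strand, which gives uniqueness of the coordinates. *)
Lemma tor_dim_strand i d : @tor_dim K n kos I i d (strand_betti i d).
Proof.
rewrite strand_bettiE; set Z := (_ :&: _)%VS; set B := (_ @: _)%VS; set C := (Z :\: B)%VS.
have BZ : (B <= Z)%VS by apply: sqdiff_strands.
have CB : (C :&: B = 0)%VS by apply: capv_diff.
have CBZ : (C + B = Z)%VS.
  by rewrite -[RHS](addv_diff_cap Z B) (capv_idPr BZ).
pose z (k : 'I_(\dim C)) : V := (vbasis C)`_k.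
have zC (k : 'I_(\dim C)) : z k \in C by rewrite vbasis_mem // mem_nth // size_tuple.
have zX (k : 'I_(\dim C)) : z k \in strand D i d.
  have : z k \in Z by rewrite (subvP (diffvSl Z B)).
  by rewrite memv_cap => /andP [].
have zker (k : 'I_(\dim C)) : sqdiff (z k) = 0.
  have : z k \in Z by rewrite (subvP (diffvSl Z B)).
  by rewrite memv_cap memv_ker => /andP [_ /eqP].
exists (fun k : 'I_(\dim C) => embed i (z k)); split=> [k|r [tr /tor_closed_diffc cr]].
  by split; [apply: embed_tensor | apply: embed_closed].
set y := sqpart (rowc r).
have yX : y \in strand D i d by apply: sqpart_strand.
have yZ : y \in Z.
  rewrite memv_cap yX memv_ker sqpart_diff; apply/eqP/ffunP => p.
  by rewrite !ffunE cr if_same.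
move: (yZ); rewrite -CBZ => /memv_addP [c hc [b hb yE]].
move: (hb) => /memv_imgP [w hw bE].
pose cf := \row_(k < \dim C) coord (vbasis C) k c.
have cE : c = \sum_(k < \dim C) cf 0 k *: z k.
  rewrite {1}(coord_vbasis hc); apply: eq_bigr => k _; by rewrite mxE.
exists cf; split=> [|cf' [x [tx ex]]].
  exists (khomot nonsqfree r + embed i.+1 w); split.
    apply: (tensor_compD (F := kos) (SR_ideal_is_ideal D)).
      exact: tensor_comp_homot.
    exact: embed_tensor.
  rewrite mulmxDl -embed_diff -bE -sqpart_homotopy // -/y yE embedD cE embed_sum.
  under [X in _ - (X + _)]eq_bigr => k _ do rewrite embedZ.
  by rewrite opprD addrA subrK.
have : y - \sum_(k < \dim C) cf' 0 k *: z k \in B.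
  rewrite -(@sqpartB_sum i r _ _ _ d) // ex.
  have -> : sqpart (rowc (x *m kdiff K n i)) = sqdiff (sqpart (rowc x)).
    by rewrite sqpart_diff; apply/ffunP => p; rewrite !ffunE rowc_diff.
  by apply: memv_img; apply: sqpart_strand.
rewrite yE cE addrAC rpredDr // => h.
have : \sum_(k < \dim C) cf 0 k *: z k - \sum_(k < \dim C) cf' 0 k *: z k \in (C :&: B)%VS.
  by rewrite memv_cap h andbT rpredB // rpred_sum // => k _; rewrite rpredZ.
rewrite CB memv0 -sumrB => /eqP h0; apply/rowP => k.
have /freeP/(_ (fun k : 'I_(\dim C) => cf 0 k - cf' 0 k))/(_ _ k) : free (vbasis C).
  exact: basis_free (vbasisP C).
move=> h1; apply/eqP; rewrite -subr_eq0 h1 // -[RHS]h0.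
by apply: eq_bigr => l _; rewrite scalerBl.
Qed.

Lemma betti_strand i d : betti I i d = strand_betti i d.
Proof. exact: (betti_eq (SR_ideal_is_ideal D) (tor_dim_strand i d)). Qed.

End Betti.
End StanleyReisner.
(** * Rank of a differential under a chain idempotent *)

Section RankComparison.
Variables (K : fieldType) (V : vectType K) (delta rho : 'End(V)) (X X' : {vspace V}).
Hypothesis rho_delta : forall v, v \in X -> rho (delta v) = delta (rho v).
Hypothesis rho_idem : forall v, v \in X' -> rho (rho v) = rho v.
Hypothesis rho_sub : (rho @: X' <= X')%VS.
Hypothesis rho_img : (rho @: X = rho @: X')%VS.
Hypothesis rho_ker : (X :&: lker rho = X' :&: lker rho)%VS.

Lemma dim_collapse : \dim X = \dim X'.
Proof. by rewrite -(limg_ker_dim rho X) -(limg_ker_dim rho X') rho_img rho_ker. Qed.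

(** The rank of [delta] on [X] is at least its rank on [X :&: lker rho] plus its
rank on [rho @: X].  On [X'] the sum of these two ranks is also an upper bound,
because [X'] contains [rho @: X'] and hence is the sum of its kernel and its
image under [rho]. *)
Lemma rank_collapse : (\dim (delta @: X') <= \dim (delta @: X))%N.
Proof.
have sub1 : (delta @: X' <= delta @: (X' :&: lker rho) + delta @: (rho @: X'))%VS.
  rewrite -limgD; apply/limgS/subvP => v vX'.
  rewrite -(subrK (rho v) v); apply: memv_add; last exact: memv_img.
  rewrite memv_cap memv_ker linearB /= rho_idem // subrr eqxx andbT.
  by rewrite rpredB // (subvP rho_sub) // memv_img.
apply: (leq_trans (dimvS sub1)); apply: (leq_trans (fst (dimv_add_leqif _ _))).
rewrite -(limg_ker_dim rho (delta @: X)); apply: leq_add; last first.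
  rewrite -rho_img; apply: dimvS; apply/subvP => w /memv_imgP [_ /memv_imgP [v vX ->] ->].
  by rewrite -rho_delta // !memv_img.
apply: dimvS; rewrite -rho_ker; apply/subvP => w /memv_imgP [v].
rewrite memv_cap memv_ker => /andP [vX /eqP v0] ->.
by rewrite memv_cap memv_img //= memv_ker rho_delta // v0 linear0.
Qed.

End RankComparison.

(** * Shifting and the identification of two variables *)

Section Shifting.
Variables (n : nat) (i j : 'I_n).
Hypothesis ij : i != j.
Implicit Types (s t : {set 'I_n}) (k : 'I_n) (D : {set {set 'I_n}}).

Definition swap s : {set 'I_n} := [set x | tperm i j x \in s].

Lemma in_swap s x : (x \in swap s) = (tperm i j x \in s).
Proof. by rewrite inE. Qed.

Lemma swapi s : (i \in swap s) = (j \in s). Proof. by rewrite in_swap tpermL. Qed.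
Lemma swapj s : (j \in swap s) = (i \in s). Proof. by rewrite in_swap tpermR. Qed.

Lemma swapK : involutive swap.
Proof. by move=> s; apply/setP => x; rewrite !in_swap tpermK. Qed.

Lemma swap_fix s : (i \in s) = (j \in s) -> swap s = s.
Proof.
move=> e; apply/setP => x; rewrite in_swap.
by case: tpermP => [->|->|//]; rewrite e.
Qed.

Lemma card_swap s : #|swap s| = #|s|.
Proof.
rewrite -(card_imset s (@perm_inj _ (tperm i j))); apply: eq_card => x.
rewrite in_swap; apply/idP/imsetP => [xs|[y ys ->]]; last by rewrite tpermK.
by exists (tperm i j x); rewrite ?tpermK.
Qed.

Lemma disjoint_swap s t : [disjoint swap s & swap t] = [disjoint s & t].
Proof.
apply/pred0P/pred0P => h x; have /= := h (tperm i j x); rewrite !in_swap.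
  by rewrite tpermK.
by [].
Qed.

Lemma swapU1 k s : swap (k |: s) = tperm i j k |: swap s.
Proof.
apply/setP => x; rewrite !inE; congr (_ || _).
by rewrite (can2_eq (tpermK _ _) (tpermK _ _)).
Qed.

Lemma swapD1 k s : swap (s :\ k) = swap s :\ tperm i j k.
Proof.
apply/setP => x; rewrite !inE; congr (~~ _ && _).
by rewrite (can2_eq (tpermK _ _) (tpermK _ _)).
Qed.

Lemma swap_exchange s : i \in s -> j \notin s -> j |: (s :\ i) = swap s.
Proof.
move=> si sj; apply/setP => x; rewrite !inE.
case: tpermP => [->|->|/eqP/negPf -> /eqP/negPf ->] //.
- by rewrite eqxx (negPf ij) (negPf sj).
- by rewrite eqxx si.
Qed.

(** A pair of sets exchanged by [swap] contributes to the shift as many members as to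
[D], those without [i] first.  This form of membership is symmetric enough to make
the properties of shifts propositional. *)
Lemma shiftP D s : (s \in shift D i j) =
  if i \in s then (s \in D) && (swap s \in D) else (s \in D) || (swap s \in D).
Proof.
apply/imsetP/idP => [[s0 s0D ->]|].
  rewrite /shift_face.
  case: (boolP [&& i \in s0, j \notin s0 & j |: (s0 :\ i) \notin D]) => [/and3P [si sj _]|].
    by rewrite swap_exchange // swapi (negPf sj) swapK s0D orbT.
  rewrite s0D /=; case: ifP => // si /=.
  case: (boolP (j \in s0)) => [sj _|sj]; first by rewrite swap_fix ?si.
  by rewrite swap_exchange // negbK.
case: ifP => si.
  move=> /andP [sD swD]; exists s => //; rewrite /shift_face si.
  by case: (boolP (j \in s)) => //= sj; rewrite swap_exchange // swD.
case: (boolP (s \in D)) => [sD _|sD /= swD].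
  by exists s => //; rewrite /shift_face si.
exists (swap s) => //; rewrite /shift_face swapi swapj si.
have sj : j \in s.
  by apply: contraR sD => /negPf sj; rewrite -(@swap_fix s) // si sj.
by rewrite sj /= swap_exchange ?swapi ?swapj ?si // swapK sD.
Qed.

Lemma shift_shift D : shift (shift D i j) i j = shift D i j.
Proof.
apply/setP => s; rewrite !shiftP swapi swapK.
by case: (i \in s); case: (j \in s); case: (s \in D); case: (swap s \in D).
Qed.

Lemma shift_down_closed D : down_closed D -> down_closed (shift D i j).
Proof.
move=> dcD s t ts; rewrite !shiftP.
have swts : swap t \subset swap s.
  by apply/subsetP => x; rewrite !in_swap; apply: (subsetP ts).
case: ifP => si.
  by move=> /andP [/(dcD _ _ ts) -> /(dcD _ _ swts) ->]; rewrite if_same.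
have -> : (i \in t) = false by apply: contraFF si; apply: (subsetP ts).
by move=> /orP [/(dcD _ _ ts) ->|/(dcD _ _ swts) ->]; rewrite ?orbT.
Qed.

Variable K : fieldType.
Local Notation face2 := ({set 'I_n} * {set 'I_n})%type.
Local Notation V := {ffun face2 -> K^o}.
Implicit Types (p : face2) (v w : V).
Local Notation sg := (ksign K).

Definition swapp p : face2 := (swap p.1, swap p.2).
Definition balanced p :=
  ((i \in p.1) == (j \in p.1)) && ((i \in p.2) == (j \in p.2)).
(** The squarefree terms that serve as representatives after identifying i and j:
either [j] does not occur, or the term contains x_i and [j] occurs as well.  A
product e_i e_j has no representative, since it becomes e_i e_i = 0. *)
Definition normal p := (j \notin p.1) && (j \notin p.2) || (i \in p.2).
(** The sign with which replacing e_i by e_j, or e_j by e_i, inside e_s gives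
e_(swap s).  It is only meaningful when at most one of [i], [j] is in [s]. *)
Definition swap_sign s : K :=
  if (i \in s) == (j \in s) then 1 else sg i (s :\ i :\ j) * sg j (s :\ i :\ j).

Lemma swappK : involutive swapp.
Proof. by case=> s t; rewrite /swapp /= !swapK. Qed.

Lemma balanced_swapp p : balanced (swapp p) = balanced p.
Proof. by rewrite /balanced /= !swapi !swapj !(eq_sym (j \in _)). Qed.

Lemma swap_signK s : swap_sign s * swap_sign s = 1.
Proof.
rewrite /swap_sign; case: ifP => _; first by rewrite mulr1.
by rewrite mulrACA !ksign_sqr mulr1.
Qed.

Lemma swap_sign_neq0 s : swap_sign s != 0.
Proof.
by apply/eqP => e; have /eqP := swap_signK s; rewrite e mul0r eq_sym oner_eq0.
Qed.

Lemma swap_sign_swap s : swap_sign (swap s) = swap_sign s.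
Proof.
rewrite /swap_sign swapi swapj (eq_sym (j \in s)); case: ifP => // _.
rewrite (_ : swap s :\ i :\ j = s :\ i :\ j) //.
apply/setP => x; rewrite !inE; case: tpermP => [->|->|//]; by rewrite ?eqxx ?andbF.
Qed.

(** The coefficient of a normal term collects its own coefficient and that of the
swapped term, unless the two terms coincide, which is [balanced]. *)
Definition collapse_fun v : V :=
  [ffun p : face2 => if normal p then
     v p + (if balanced p then 0 else swap_sign p.1 * v (swapp p)) else 0].

Fact collapse_is_linear : linear collapse_fun.
Proof.
move=> c u v; apply/ffunP => p; rewrite !ffunE /=.
case: ifP => _; last by rewrite scaler0 addr0.
case: ifP => _; first by rewrite !addr0.
by rewrite mulrDr scalerDr scalerAr addrACA.
Qed.
HB.instance Definition _ := GRing.isLinear.Build K V V *:%R collapse_fun collapse_is_linear.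
Definition collapse : 'End(V) := linfun collapse_fun.

Lemma collapseE v p : collapse v p = (if normal p then
     (v p : K) + (if balanced p then 0 else swap_sign p.1 * v (swapp p)) else 0) :> K.
Proof. by rewrite lfunE ffunE. Qed.

Lemma normal_swapp p : [disjoint p.1 & p.2] -> normal p -> ~~ balanced p ->
  ~~ normal (swapp p).
Proof.
case: p => s t /= st; rewrite /normal /balanced /= !swapi !swapj.
have nd x : ~~ ((x \in s) && (x \in t)).
  by apply/negP => /andP [xs]; rewrite (disjointFr st xs).
have := nd i; have := nd j.
by case: (i \in s); case: (j \in s); case: (i \in t); case: (j \in t).
Qed.

Lemma swap_sign1 (k l : 'I_n) (u : {set 'I_n}) : (k == i) && (l == j) || (k == j) && (l == i) ->
  k \notin u -> l \notin u -> swap_sign (k |: u) = sg k u * sg l u.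
Proof.
have e (x y : 'I_n) : x \notin u -> y \notin u -> (x |: u) :\ x :\ y = u.
  move=> xu yu; rewrite setU1K //; apply/setP => z; rewrite !inE.
  by case: eqP => [->|//]; rewrite (negPf yu).
have ji : (j == i) = false by rewrite eq_sym (negPf ij).
move=> /orP [] /andP [/eqP -> /eqP ->] ku lu; rewrite /swap_sign !in_setU1 !eqxx
   ?(negPf ku) ?(negPf lu) ?(negPf ij) ?ji /=.
  by rewrite e.
have -> : (j |: u) :\ i :\ j = u by rewrite setDDl [[set i] :|: _]setUC -setDDl e.
by rewrite mulrC.
Qed.

Lemma ksign_replace (k l x : 'I_n) (u : {set 'I_n}) : x != k -> x != l -> k \notin u -> l \notin u -> x \notin u ->
  sg k u * sg l u * sg x (l |: u) = sg x (k |: u) * (sg k (x |: u) * sg l (x |: u)).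
Proof.
move=> xk xl ku lu xu; rewrite (ksign_swap K xl xu lu) (ksign_swap K xk xu ku).
have := ksign_sqr K l u; have := ksign_sqr K k (x |: u).
move: (sg k (x |: u)) (sg l (x |: u)) (sg k u) (sg l u) (sg x u) => d e a b c dd bb.
transitivity (- (a * c * e) * (b * b)); first by ring.
transitivity (- (a * c * e) * (d * d)); first by rewrite dd bb.
by ring.
Qed.

(** Replacing e_i by e_j commutes with contracting any third e_k. *)
Lemma ksign_swap_sign k s : k != i -> k != j -> k \notin s ->
  ~~ ((i \in s) && (j \in s)) ->
  swap_sign s * sg k (swap s) = sg k s * swap_sign (k |: s).
Proof.
have one a b u : (a == i) && (b == j) || (a == j) && (b == i) ->
    k != a -> k != b -> k \notin a |: u -> a \notin u -> b \notin u ->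
    swap_sign (a |: u) * sg k (b |: u) = sg k (a |: u) * swap_sign (k |: (a |: u)).
  rewrite in_setU1 negb_or => eab ka kb /andP [_ ku] au bu.
  have a' : a \notin k |: u by rewrite in_setU1 negb_or eq_sym ka.
  have b' : b \notin k |: u by rewrite in_setU1 negb_or eq_sym kb.
  by rewrite setUCA !(@swap_sign1 a b) // ksign_replace.
move=> ki kj ks; case: (boolP (i \in s)) => si /=; case: (boolP (j \in s)) => sj //= _.
- have iu : i \notin s :\ i by rewrite !inE eqxx.
  have ju : j \notin s :\ i by rewrite !inE (negPf sj) andbF.
  have sE : s = i |: (s :\ i) by rewrite setD1K.
  have -> : swap s = j |: (s :\ i) by rewrite swap_exchange.
  by rewrite {1 3 4}sE; apply: one => //; rewrite ?eqxx // -sE.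
- have ju : j \notin s :\ j by rewrite !inE eqxx.
  have iu : i \notin s :\ j by rewrite !inE (negPf si) andbF.
  have sE : s = j |: (s :\ j) by rewrite setD1K.
  have -> : swap s = i |: (s :\ j).
    by rewrite {1}sE swapU1 tpermR swap_fix // (negPf iu) (negPf ju).
  by rewrite {1 3 4}sE; apply: one => //; rewrite ?eqxx ?orbT // -sE.
rewrite swap_fix ?(negPf si) ?(negPf sj) // /swap_sign !in_setU1.
by rewrite (negPf si) (negPf sj) !(eq_sym _ k) (negPf ki) (negPf kj) eqxx mul1r mulr1.
Qed.

Definition on_disjoint v := forall s t, ~~ [disjoint s & t] -> v (s, t) = 0.

Lemma sqdiff_on_disjoint v : on_disjoint v -> on_disjoint (sqdiff K n v).
Proof.
move=> hv s t st; rewrite lfunE ffunE /= big1 // => k /andP [ks kt].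
rewrite hv ?mulr0 //; apply: contra st => st.
apply/pred0P => x /=; apply/negP => /andP [xs xt].
have /pred0P/(_ x) := st; rewrite /= !inE xs xt orbT andbT /=.
by case: eqP => // e; rewrite -e xs in ks.
Qed.

Lemma collapse_on_disjoint v : on_disjoint v -> on_disjoint (collapse v).
Proof.
move=> hv s t st; rewrite collapseE; case: ifP => // _.
by rewrite !hv ?disjoint_swap // mulr0 if_same addr0.
Qed.

(** Both sides are sums over [k] in [t].  They agree term by term, except when [i] and
[j] are both in [t]: then the terms for k = i and k = j agree only jointly, which
reflects that d(e_i x_j) and d(e_j x_i) are both x_i x_j. *)
Lemma collapse_sqdiff v : on_disjoint v ->
  collapse (sqdiff K n v) = sqdiff K n (collapse v).
Proof.
move=> hv; apply/ffunP => -[s t].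
have [st|st] := boolP [disjoint s & t]; last first.
  by rewrite (collapse_on_disjoint (sqdiff_on_disjoint hv) st)
     (sqdiff_on_disjoint (collapse_on_disjoint hv) st).
pose R k : K := if normal (s, t) then sg k s * v (k |: s, t :\ k) +
   (if balanced (s, t) then 0 else
     swap_sign s * (sg (tperm i j k) (swap s) * v (swap (k |: s), swap (t :\ k)))) else 0.
pose L k : K := sg k s * collapse v (k |: s, t :\ k).
have -> : sqdiff K n (collapse v) (s, t) = \sum_(k in t) L k.
  rewrite lfunE ffunE /=; apply: eq_bigl => k.
  by case: (boolP (k \in t)) => kt; rewrite ?andbF // (disjointFl st kt).
have -> : collapse (sqdiff K n v) (s, t) = \sum_(k in t) R k.
  rewrite collapseE /R; case: ifP => _; last by rewrite big1.
  rewrite big_split /= lfunE ffunE /=; congr (_ + _).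
    apply: eq_bigl => k.
    by case: (boolP (k \in t)) => kt; rewrite ?andbF // (disjointFl st kt).
  case: ifP => _; first by rewrite big1.
  rewrite ffunE mulr_sumr (reindex_inj (@perm_inj _ (tperm i j))) /=.
  apply: eq_big => [k|k _].
    rewrite !in_swap !tpermK.
    by case: (boolP (k \in t)) => kt; rewrite ?andbF // (disjointFl st kt).
  by rewrite swapU1 swapD1.
(* [swap (k |: s)] and [swap (t :\ k)] in [R] come from reindexing the sum for the
   swapped term by the transposition. *)
have termwise k : k \in t -> ~~ ((i \in t) && (j \in t) && ((k == i) || (k == j))) ->
    R k = L k.
  move=> kt; have ks : k \notin s by rewrite (disjointFl st kt).
  case: (eqVneq k i) kt ks => [->|ki] kt ks.
    rewrite kt ?orbT /= andbT => tj; rewrite /R /L collapseE /normal /balanced /=.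
    rewrite kt (negPf tj) (negPf ks) !in_setU1 !in_setD1 !eqxx (eq_sym j) (negPf ij) /=.
    rewrite orbT andbF (negPf tj) /= andbT orbF tpermL.
    case: (boolP (j \in s)) => sj /=; last first.
      rewrite swap_fix ?(negPf ks) ?(negPf sj) // (@swap_sign1 i j) ?eqxx //.
      by rewrite {1}/swap_sign (negPf ks) (negPf sj) eqxx mul1r mulrDr !mulrA ksign_sqr mul1r.
    rewrite [swap (i |: s)]swap_fix ?in_setU1 ?eqxx ?sj ?orbT //.
    rewrite [swap (t :\ i)]swap_fix ?in_setD1 ?eqxx ?(negPf tj) ?andbF //.
    rewrite mulrA -mulrDl mulr0; apply/eqP; rewrite mulf_eq0; apply/orP; left; apply/eqP.
    have ju : j \notin s :\ j by rewrite !inE eqxx.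
    have iu : i \notin s :\ j by rewrite !inE (negPf ks) andbF.
    have sE : s = j |: (s :\ j) by rewrite setD1K.
    have -> : swap s = i |: (s :\ j).
      by rewrite {1}sE swapU1 tpermR swap_fix // (negPf iu) (negPf ju).
    have es : swap_sign s = sg j (s :\ j) * sg i (s :\ j).
      by rewrite {1}sE (@swap_sign1 j i) ?eqxx ?orbT.
    have ei : sg i s = sg i (j |: (s :\ j)) by rewrite -sE.
    rewrite es ei (@ksign_swap K n j i) // 1?eq_sym // mulrN.
    have := ksign_sqr K j (s :\ j); have := ksign_sqr K i (s :\ j).
    move: (sg i (j |: s :\ j)) (sg j (s :\ j)) (sg i (s :\ j)) => z x y yy xx.
    transitivity (z - z * (x * x) * (y * y)); first by ring.
    by rewrite xx yy !mulr1 subrr.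
  case: (eqVneq k j) kt ks ki => [->|kj] kt ks ki.
    rewrite kt ?orbT !andbT => ti; rewrite /R /L collapseE /normal /balanced /=.
    rewrite kt (negPf ti) /= andbF !in_setU1 !in_setD1 !eqxx (negPf ij) (negPf ti) /=.
    by rewrite mulr0.
  move=> _; rewrite /R /L collapseE.
  have -> : normal (k |: s, t :\ k) = normal (s, t).
    by rewrite /normal /= !in_setU1 !in_setD1 !(eq_sym _ k) (negPf ki) (negPf kj).
  have -> : balanced (k |: s, t :\ k) = balanced (s, t).
    by rewrite /balanced /= !in_setU1 !in_setD1 !(eq_sym _ k) (negPf ki) (negPf kj).
  case: ifP => [nst|_]; last by rewrite mulr0.
  case: ifP => _; first by rewrite !addr0.
  rewrite mulrDr tpermD 1?eq_sym // mulrA ksign_swap_sign //.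
    by rewrite /swapp mulrA.
  apply/negP => /andP [si sj]; move: nst.
  by rewrite /normal /= sj (disjointFr st si).
have [/andP [ti tj]|tij] := boolP ((i \in t) && (j \in t)); last first.
  by apply: eq_bigr => k kt; apply: termwise; rewrite ?(negPf tij).
rewrite (bigD1 i) //= [in RHS](bigD1 i) //= (bigD1 j) /=; last by rewrite tj eq_sym.
rewrite [X in _ = _ + X](bigD1 j) /=; last by rewrite tj eq_sym.
rewrite !addrA; congr (_ + _); last first.
  by apply: eq_bigr => k /andP [/andP [kt ki] kj]; rewrite termwise // (negPf ki) (negPf kj) andbF.
have si : i \notin s by rewrite (disjointFl st ti).
have sj : j \notin s by rewrite (disjointFl st tj).
rewrite /R /L !collapseE /normal /balanced /= !in_setU1 !in_setD1 !eqxx ti tj.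
rewrite (negPf si) (negPf sj) (eq_sym j) (negPf ij) /= !addr0 mulr0 add0r.
rewrite (@swap_sign1 j i) ?eqxx ?orbT // mulrDr !mulrA ksign_sqr mul1r addrC.
by rewrite /swapp /= swapU1 swapD1 tpermR !swap_fix ?(negPf si) ?(negPf sj) ?ti ?tj.
Qed.

Definition graded (q : nat) (d : int) p :=
  [&& [disjoint p.1 & p.2], #|p.1| == q & (q + #|p.2|)%:Z == d].

Lemma graded_swapp q d p : graded q d (swapp p) = graded q d p.
Proof. by rewrite /graded /= disjoint_swap !card_swap. Qed.

Lemma strandP D q d v :
  reflect (forall p, v p != 0 -> graded q d p /\ p.2 \notin D) (v \in strand K D q d).
Proof.
apply: (iffP (supportedP _ _)) => h p /h; first by case/and4P=> *; split=> //; apply/and3P.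
by case=> /and3P [-> -> ->].
Qed.

Lemma strand_on_disjoint D q d v : v \in strand K D q d -> on_disjoint v.
Proof.
move=> /strandP h s t st; apply/eqP; apply: contraR st => /h [].
by rewrite /graded => /andP [].
Qed.

Lemma collapse_idem v : on_disjoint v -> collapse (collapse v) = collapse v.
Proof.
move=> hv; apply/ffunP => -[s t].
have [st|st] := boolP [disjoint s & t]; last first.
  by rewrite !(collapse_on_disjoint _ st) //; apply: collapse_on_disjoint.
rewrite [LHS]collapseE; case: (boolP (normal (s, t))) => [nst|/negPf nst]; last first.
  by rewrite collapseE nst.
rewrite /=; case: ifP => [_|/negbT bst]; first by rewrite addr0.
by rewrite [collapse v (swapp _)]collapseE (negPf (normal_swapp _ nst bst)) // mulr0 addr0.
Qed.

Section Strand.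
Variables (D : {set {set 'I_n}}) (q : nat) (d : int).
Local Notation D' := (shift D i j).

(** A normal term whose [t] omits [i] also omits [j] there, so [t] is its own swap;
if [t] contains [i], it suffices for the shift that one of [t] and its swap is
outside [D]. *)
Lemma collapse_strand v : v \in strand K D q d -> collapse v \in strand K D' q d.
Proof.
move=> /strandP h; apply/strandP => p; rewrite collapseE.
case: ifP => [np|]; last by rewrite eqxx.
move=> hp; have {hp} : (v p != 0) || (~~ balanced p && (v (swapp p) != 0)).
  move: hp; case: (balanced p) => /=; first by rewrite addr0 orbF.
  have [->|//] := eqVneq (v p) 0; rewrite add0r mulf_eq0 negb_or => /andP [_ ->].
  by rewrite orbT.
have gp : (v p != 0) || (~~ balanced p && (v (swapp p) != 0)) ->
    graded q d p /\ ((p.2 \notin D) || (swap p.2 \notin D)).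
  move=> /orP [/h [-> ->] //|/andP [_ /h [/=]]].
  by rewrite graded_swapp => -> ->; rewrite orbT.
move=> /gp [-> hD]; split=> //; rewrite shiftP; move: np; rewrite /normal.
case: ifP => pi; first by rewrite negb_and.
rewrite orbF => /andP [_ pj]; move: hD.
by rewrite swap_fix ?pi ?(negPf pj) // !orbb.
Qed.

Lemma shift_notin s : s \notin D' -> (s \notin D) || (swap s \notin D).
Proof. by rewrite shiftP; case: ifP => _; [rewrite negb_and | case/norP => ->]. Qed.

(** For [v] in the kernel, a term and its swap either both occur or both do not when
one of them is normal and they differ.  So both belong to the strand, and the
membership conditions for [D] and its shift agree on such a pair. *)
Lemma collapse_ker v : collapse v = 0 -> (v \in strand K D q d) = (v \in strand K D' q d).
Proof.
move=> cv0.
have cv p : normal p -> ~~ balanced p -> (v (swapp p) != 0) = (v p != 0).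
  move=> np bp; have /ffunP/(_ p) := cv0; rewrite collapseE np (negPf bp) ffunE.
  move/eqP; rewrite addrC addr_eq0 => /eqP e.
  by rewrite -[in RHS]oppr_eq0 -e mulf_eq0 negb_or swap_sign_neq0.
apply/strandP/strandP => h p vp; have [gp pD] := h p vp; split=> //.
  rewrite shiftP; case: ifP => pi; first by rewrite (negPf pD).
  rewrite negb_or pD /=; case: (boolP (j \in p.2)) => pj; last first.
    by rewrite swap_fix // pi (negPf pj).
  have ns : normal (swapp p) by rewrite /normal /= !swapi pj orbT.
  have bs : ~~ balanced (swapp p) by rewrite balanced_swapp /balanced pi pj andbF.
  by have := cv _ ns bs; rewrite swappK vp => /esym /h [].
move: (pD); rewrite shiftP; case: ifP => pi; last by case/norP.
rewrite negb_and => /orP [//|spD].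
case: (boolP (balanced p)) => [/andP [_ /eqP bp]|bp].
  by move: spD; rewrite swap_fix.
have np : normal p by rewrite /normal pi orbT.
have := cv _ np bp; rewrite vp => /h [_ /=].
by rewrite shiftP swapi swapK; case: ifP => [pj|_ /norP [] //]; rewrite negb_and -(@swap_fix p.2) ?pi ?pj // orbb.
Qed.

(** A normal term e_s x_t that is allowed for the shift has [t] or [swap t] outside
[D].  In the first case it is its own preimage; otherwise its swapped term is one,
up to sign. *)
Lemma collapse_lift x : x \in strand K D' q d -> collapse x = x ->
  exists2 w, w \in strand K D q d & collapse w = x.
Proof.
move=> /strandP h cx.
have x_normal p : ~~ normal p -> x p = 0.
  by move=> np; rewrite -cx collapseE (negPf np).
pose w : V := [ffun p : face2 =>
  if normal p then if p.2 \notin D then x p else 0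
  else if ~~ balanced p && (swap p.2 \in D) then swap_sign p.1 * x (swapp p) else 0].
have hw : w \in strand K D q d.
  apply/strandP => p; rewrite ffunE; case: ifP => np.
    by case: ifP => [pD /h [] //|]; rewrite eqxx.
  case: ifP => [/andP [bp spD]|]; last by rewrite eqxx.
  rewrite mulf_eq0 (negPf (swap_sign_neq0 _)) /= => /h [/=].
  by rewrite graded_swapp => -> /shift_notin; rewrite swapK spD.
exists w => //; apply/ffunP => p.
have [pdis|pdis] := boolP [disjoint p.1 & p.2]; last first.
  case: p pdis => s t st; rewrite (collapse_on_disjoint (strand_on_disjoint hw) st).
  by apply/esym/eqP; apply: contraR st => /h [/and3P []].
rewrite collapseE; case: (boolP (normal p)) => np /=; last by rewrite x_normal.
rewrite !ffunE np; case: (boolP (balanced p)) => bp.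
  rewrite addr0; case: ifP => // /negbFE pD; apply/esym/eqP.
  apply/negP => /negP /h [_ /shift_notin].
  by rewrite swap_fix ?orbb ?pD //; case/andP: bp => _ /eqP.
rewrite (negPf (normal_swapp pdis np bp)) balanced_swapp bp /= swapK swappK swap_sign_swap.
case: (p.2 \in D); first by rewrite mulrA swap_signK mul1r add0r.
by rewrite mulr0 addr0.
Qed.

End Strand.

(** The image of the strand of the shift under [collapse] stays in that strand
because the shift is its own shift. *)
Lemma strand_betti_shift D q d :
  (strand_betti K D q d <= strand_betti K (shift D i j) q d)%N.
Proof.
have img r : (collapse @: strand K D r d = collapse @: strand K (shift D i j) r d)%VS.
  apply/eqP; rewrite eqEsubv; apply/andP; split; apply/subvP => x /memv_imgP [v hv ->].
    rewrite -(collapse_idem (strand_on_disjoint hv)).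
    by apply: memv_img; apply: collapse_strand.
  have [||w hw <-] := @collapse_lift D r d (collapse v).
  - by rewrite -shift_shift; apply: collapse_strand.
  - exact: collapse_idem (strand_on_disjoint hv).
  exact: memv_img.
have ker r : (strand K D r d :&: lker collapse =
              strand K (shift D i j) r d :&: lker collapse)%VS.
  apply/vspaceP => v; rewrite !memv_cap memv_ker.
  by case: eqP => [v0|]; rewrite ?andbF // (collapse_ker D r d v0).
have rank r := @rank_collapse K V (sqdiff K n) collapse (strand K D r d) (strand K (shift D i j) r d).
have dims r : \dim (strand K D r d) = \dim (strand K (shift D i j) r d).
  exact: (@dim_collapse K V collapse _ _ (img r) (ker r)).
have ranks r : (\dim (sqdiff K n @: strand K (shift D i j) r d) <=
                \dim (sqdiff K n @: strand K D r d))%N.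
  apply: rank; [| | | exact: img | exact: ker].
  - by move=> v /strand_on_disjoint hv; apply: collapse_sqdiff.
  - by move=> v /strand_on_disjoint hv; apply: collapse_idem.
  - apply/subvP => x /memv_imgP [v hv ->].
    by rewrite -shift_shift; apply: collapse_strand.
by rewrite /strand_betti dims -!subnDA leq_sub2l // leq_add.
Qed.

End Shifting.

Theorem theorem3p4 (K : fieldType) (n : nat) (D Dc : {set {set 'I_n}})
    (hD : simplicial_complex D)
    (hDc : combinatorial_shifted_complex D Dc)
    (i : nat) (j : int) :
  (betti (SR_ideal (K := K) D) i (i%:Z + j)%R
     <= betti (SR_ideal (K := K) Dc) i (i%:Z + j)%R)%N.
Proof.
have dcD : down_closed D by case: hD.
case: hDc => -[ps [ps_lt ->]] _; elim: ps D {hD} dcD ps_lt => [//|[a b] ps IH] D dcD ps_lt.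
have ab : a != b by rewrite -val_eqE /= ltn_eqF // (ps_lt (a, b)) // inE eqxx.
have dcD' := shift_down_closed ab dcD.
apply: leq_trans (IH _ dcD' _); last by move=> p pps; apply: ps_lt; rewrite inE pps orbT.
by rewrite !betti_strand // strand_betti_shift.
Qed.
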